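(* Let $j>1$ be an integer. For $f\in C[0,1]$, $x\in[0,1]$ and every integer $n\ge j$ we have $$|f(x)-B_{n,0,j}(f;x)|\le \inf_{l}\left\{\omega_2\left(f-l;\frac{1}{\sqrt n}\right)+\omega_1\left(f-l;\frac{j-1}{n}\right)\right\},$$ where the infimum is taken over all functions $l$ of the form $l=a e_j$, i.e. $l(t)=a t^j$ for $t\in[0,1]$, with $a\in\mathbb{R}$.
   Context: $C[0,1]$ is the space of real-valued continuous functions on $[0,1]$, and $e_j(t)=t^j$. For integers $n\ge j$, the operator $B_{n,0,j}$ of Aldaz, Kounchev and Render is defined for $f\in C[0,1]$, $x\in[0,1]$ by $$B_{n,0,j}(f;x)=\sum_{k=0}^n f\left(t_{n,k}^j\right)p_{n,k}(x),\qquad p_{n,k}(x)=\binom{n}{k}x^k(1-x)^{n-k},$$ $$t_{n,k}^j=\left(\frac{k(k-1)\cdots(k-j+1)}{n(n-1)\cdots(n-j+1)}\right)^{1/j}.$$ The classical moduli of continuity of first and second order are, for $\delta\ge 0$, $$\omega_1(f;\delta)=\sup\{|f(u)-f(v)|: u,v\in[0,1],\ |u-v|\le\delta\},$$ $$\omega_2(f;\delta)=\sup\{|f(u+h)-2f(u)+f(u-h)|: 0\le h\le\delta,\ u-h,\,u+h\in[0,1]\}.$$ *)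

(* Defs.v *)
From HB Require Import structures.
From mathcomp Require Import all_boot all_order all_algebra.
From mathcomp Require Import all_classical all_reals all_analysis.

Set Implicit Arguments.
Unset Strict Implicit.
Unset Printing Implicit Defensive.

Import Order.TTheory GRing.Theory Num.Theory.
Import numFieldNormedType.Exports.

Local Open Scope classical_set_scope.
Local Open Scope ring_scope.

(* An element of C[0,1] is a total function f : R -> R that is continuous
   within `[0, 1]; every definition below only reads f on `[0, 1]. *)

Definition monomial (R : realType) (j : nat) : R -> R := fun t => t ^+ j.

Definition bernstein_basis (R : realType) (n k : nat) (x : R) : R :=
  'C(n, k)%:R * x ^+ k * (1 - x) ^+ (n - k).

(* akr stands for Aldaz, Kounchev and Render.
   k ^_ j is the falling factorial k (k - 1) ... (k - j + 1), which is 0 for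
   k < j; since 0 `^ p = 0 for p != 0, the node is then 0 when 0 < j. *)
Definition akr_node (R : realType) (n j k : nat) : R :=
  ((k ^_ j)%:R / (n ^_ j)%:R) `^ j%:R^-1.

Definition akr_operator (R : realType) (n j : nat) (f : R -> R) (x : R) : R :=
  \sum_(k < n.+1) f (akr_node R n j k) * bernstein_basis n k x.

(* For f continuous on `[0, 1] and 0 <= delta the sets below are nonempty and
   bounded, so the real-valued sup is the genuine supremum. *)
Definition omega1 (R : realType) (f : R -> R) (delta : R) : R :=
  sup [set y | exists u v : R,
    [/\ u \in `[0, 1], v \in `[0, 1], `|u - v| <= delta
      & y = `|f u - f v| ] ].

Definition omega2 (R : realType) (f : R -> R) (delta : R) : R :=
  sup [set y | exists u h : R,
    [/\ 0 <= h <= delta, u - h \in `[0, 1], u + h \in `[0, 1]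
      & y = `|f (u + h) - 2 * f u + f (u - h)| ] ].

(* Main.v *)
Require Import Defs.
From HB Require Import structures.
From mathcomp Require Import all_boot all_order all_algebra.
From mathcomp Require Import all_classical all_reals all_analysis.
From mathcomp Require Import ring lra zify.

Set Implicit Arguments.
Unset Strict Implicit.
Unset Printing Implicit Defensive.

Import Order.TTheory GRing.Theory Num.Theory.
Import numFieldNormedType.Exports.

Local Open Scope classical_set_scope.
Local Open Scope ring_scope.

(** Put g = f - l.  The operator reproduces constants and the monomial of
    degree j, so the claim is that B g - g and its opposite are at most W + om
    at x, where W and om are the two moduli of g.

    A function whose second differences of step h are at most W lies, on the
    whole segment, below some parabola
      g x + m (t - x) + W (1 + (t - x)^2 / (2 h^2))
    [quadratic_majorant].  With h^2 = 1 / n, integrating it against the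
    Bernstein weights p_k placed at the points k / n gives g x + W (1 + s / 2),
    s = x (1 - x): too much by W s / 2.  The excess is won back from the slack
    q = parabola - g.  It is nonnegative, equals W at x, and satisfies
    q (x + u) + q (x - u) >= W (1 + n u^2) because the second difference of g
    at x is at most W.  So mass sitting at x, or sitting in pairs symmetric
    about x, yields a gain.

    The modulus om pays for choosing where the mass sits: the value of g at the
    k-th node may be replaced, at cost om, by its value at any point of the
    segment within (j - 1) / n of that node, in particular at k / n, which lies
    in this range.  Everything then reduces [transport_bound] to a purely
    binomial problem: move the weights p_k inside their ranges so that the mean
    ends up on a prescribed side of x (to dispose of the unknown slope m, whose
    sign decides the side), while the mass at x or in symmetric pairs dominates
    the second moment of the remainder.  Two constructions solve it.

    If n s^3 <= 23 / 100, a mass s / 2 taken from one weight next to the mean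
    is moved to x itself [atom_transport].  That this weight is at least s / 2
    follows from de Moivre's formula for the mean absolute deviation, bounded
    below through the second and fourth moments.

    If n s^3 >= 23 / 100, the distribution is so smooth that it nearly
    coincides with its mirror image about a point C just above the mean, twice
    of which is an integer.  The common part of the two has mass at least
    13 s / 10 and, once each of its points above C is lowered by the same
    amount of at most one unit, it is symmetric about the mean
    [mirror_transport].  The size of the common part rests on an upper bound for
    the relative difference of p at C - i and C + i, obtained by multiplying up
    the ratios of consecutive weights [mirror_closeness] and summed in
    [overlap_ge].

    From the reduction on, lengths are measured in units of 1 / n: the mean is
    y = n x, the variance is V = n s, and the k-th node is n times akr_node. *)

(** * A parabola above a function with bounded second differences *)

Section SupportLine.
Variable R : realType.
Implicit Types (g : R -> R) (a b h x W : R).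

(** Bending the chord down by a parabola of curvature slightly above W / h^2
    makes E = g - chord + parabola vanish at both ends.  Compare E at a minimum
    point c with its values at c - t and c + t, t being the largest admissible
    step: for t = h the second difference of E would be negative, which is
    impossible at a minimum; otherwise c - t or c + t is an end point, where E
    is 0, and the second difference gives E c >= - W. *)
Lemma chord_gap g h W a b x :
  0 < h -> 0 <= W -> {within `[a, b], continuous g} ->
  (forall u t, 0 <= t <= h -> a <= u - t -> u + t <= b ->
     `|g (u + t) - 2 * g u + g (u - t)| <= W) ->
  a < x < b ->
  (b - x) * g a + (x - a) * g b - (b - a) * g x <=
    W * (b - a) * (1 + (x - a) * (b - x) / (2 * h ^+ 2)).
Proof.
move=> h0 W0 gc gW /andP[ax xb].
have ab : a < b := lt_trans ax xb.
have ba0 : 0 < b - a by rewrite subr_gt0.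
have ba0' : b - a != 0 by rewrite gt_eqF.
have hh0 : h != 0 by rewrite gt_eqF.
pose c0 := (x - a) * (b - x) / (2 * h ^+ 2).
have c00 : 0 <= c0.
  by rewrite divr_ge0 ?mulr_ge0 ?subr_ge0 ?(ltW ax) ?(ltW xb) ?exprn_ge0 ?(ltW h0).
apply/ler_addgt0Pr => e e0.
(* The excess eta of the curvature makes the second difference of E
   strictly negative at the full step h. *)
pose eta := e / ((b - a) * (c0 + 1)).
have eta0 : 0 < eta by rewrite divr_gt0 // mulr_gt0 // ltr_wpDl.
pose sl := (g b - g a) / (b - a).
pose P t := (W + eta) / (2 * h ^+ 2) * ((t - a) * (b - t)) - (g a + sl * (t - a)).
pose E t := g t + P t.
have Pc : continuous P.
  move=> t; rewrite /P; apply: cvgB; last first.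
    apply: cvgD; first exact: cvg_cst.
    by apply: cvgM; [exact: cvg_cst|apply: cvgB; [exact: cvg_id|exact: cvg_cst]].
  apply: cvgM; first exact: cvg_cst.
  by apply: cvgM; apply: cvgB; first [exact: cvg_cst|exact: cvg_id].
have Ec : {within `[a, b], continuous E}.
  exact: (within_continuousD gc (continuous_subspaceT Pc)).
have [c cab cmin] := EVT_min (ltW ab) Ec.
have Ea : E a = 0 by rewrite /E /P subrr !(mul0r, mulr0) addr0 sub0r subrr.
have Eb : E b = 0 by rewrite /E /P /sl divfK // subrr !mulr0; lra.
have Ec_ge : - W <= E c.
  have [ac cb] : a <= c /\ c <= b by move: cab; rewrite in_itv /= => /andP[].
  move: ac; rewrite le_eqVlt => /orP[/eqP <-|ac]; first by rewrite Ea oppr_le0.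
  move: cb; rewrite le_eqVlt => /orP[/eqP ->|cb]; first by rewrite Eb oppr_le0.
  pose t := Num.min h (Num.min (c - a) (b - c)).
  have t0 : 0 < t by rewrite !lt_min h0 !subr_gt0 ac cb.
  have th : t <= h by rewrite /t ge_min lexx.
  have tca : t <= c - a by rewrite /t !ge_min lexx ?orbT.
  have tbc : t <= b - c by rewrite /t !ge_min lexx ?orbT.
  have Dg : g (c + t) - 2 * g c + g (c - t) <= W.
    apply: le_trans (ler_norm _) _; apply: gW; first by rewrite (ltW t0) th.
      by lra.
    by lra.
  have DE : E (c + t) - 2 * E c + E (c - t) <= W - (W + eta) * (t / h) ^+ 2.
    rewrite [leLHS](_ : _ = (g (c + t) - 2 * g c + g (c - t))
        - (W + eta) * (t / h) ^+ 2); first by rewrite lerD2r.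
    by rewrite /E /P; field; rewrite gt_eqF.
  have m1 : E c <= E (c + t).
    by apply: cmin; rewrite in_itv /=; apply/andP; split; lra.
  have m2 : E c <= E (c - t).
    by apply: cmin; rewrite in_itv /=; apply/andP; split; lra.
  have q0 : 0 <= (W + eta) * (t / h) ^+ 2.
    by rewrite mulr_ge0 ?exprn_even_ge0 // addr_ge0 // ltW.
  have : [\/ t = h, t = c - a | t = b - c].
    rewrite /t; case: (leP h (Num.min (c - a) (b - c))) => _; first by constructor 1.
    by case: (leP (c - a) (b - c)) => _; [constructor 2|constructor 3].
  case=> tE.
  - move: DE; rewrite tE divff ?gt_eqF// expr1n => DE.
    by move: m1 m2; rewrite tE; lra.
  - by move: DE m1; rewrite [c - t](_ : _ = a) ?Ea; [lra|rewrite tE; ring].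
  - by move: DE m2; rewrite [c + t](_ : _ = b) ?Eb; [lra|rewrite tE; ring].
have Ex : - W <= E x.
  by apply: le_trans Ec_ge (cmin _ _); rewrite in_itv /= (ltW ax) (ltW xb).
have : - W * (b - a) <= E x * (b - a) by rewrite ler_pM2r.
have -> : E x * (b - a) = (b - a) * g x - (b - x) * g a - (x - a) * g b
    + (W + eta) * (b - a) * c0.
  by rewrite /E /P /sl /c0; field; rewrite hh0.
have etae : eta * (b - a) * c0 <= e.
  rewrite [leLHS](_ : _ = e * (c0 / (c0 + 1))); last first.
    by rewrite /eta; field; rewrite ba0' gt_eqF // ltr_wpDl.
  by rewrite ler_piMr ?(ltW e0)// ler_pdivrMr ?mul1r ?ltr_wpDl// lerDl.
rewrite -/c0; lra.
Qed.

(** Let G be g minus the parabola of slope 0.  Slopes that work to the right of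
    x are those above all values of G b / (b - x), slopes that work to the left
    those below all values of - G a / (x - a).  By the chord estimate every value of the first kind is at
    most every value of the second, so the supremum of the former serves. *)
Lemma quadratic_majorant g h W x :
  0 < h -> 0 <= W -> {within `[0, 1], continuous g} ->
  (forall u t, 0 <= t <= h -> 0 <= u - t -> u + t <= 1 ->
     `|g (u + t) - 2 * g u + g (u - t)| <= W) ->
  0 < x < 1 ->
  exists m, forall t, 0 <= t <= 1 ->
    g t <= g x + m * (t - x) + W * (1 + (t - x) ^+ 2 / (2 * h ^+ 2)).
Proof.
move=> h0 W0 gc gW /andP[x0 x1].
pose G t := g t - g x - W * (1 + (t - x) ^+ 2 / (2 * h ^+ 2)).
pose S := [set G b / (b - x) | b in [set b | x < b <= 1]].
have hh0 : h != 0 by rewrite gt_eqF.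
have slopes a b : 0 <= a < x -> x < b <= 1 -> G b / (b - x) <= - G a / (x - a).
  move=> /andP[a0 ax] /andP[xb b1].
  have xa0 : 0 < x - a by rewrite subr_gt0.
  have bx0 : 0 < b - x by rewrite subr_gt0.
  rewrite ler_pdivrMr // mulrAC ler_pdivlMr //.
  have gc' : {within `[a, b], continuous g}.
    apply: continuous_subspaceW gc => t /=; rewrite !in_itv /= => /andP[at_ tb].
    by rewrite (le_trans a0 at_) (le_trans tb b1).
  have gW' u t : 0 <= t <= h -> a <= u - t -> u + t <= b ->
      `|g (u + t) - 2 * g u + g (u - t)| <= W.
    by move=> ht au ub; apply: gW => //; lra.
  have := chord_gap h0 W0 gc' gW' (_ : a < x < b); rewrite ax xb => /(_ isT).
  rewrite -subr_ge0 => ineq.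
  rewrite -subr_ge0 [leRHS](_ : _ = W * (b - a) * (1 + (x - a) * (b - x) / (2 * h ^+ 2))
      - ((b - x) * g a + (x - a) * g b - (b - a) * g x)) //.
  by rewrite /G; field.
have ubS : ubound S (- G 0 / x).
  move=> _ [b /= xb1 <-]; rewrite (_ : - G 0 / x = - G 0 / (x - 0)) ?subr0 //.
  by rewrite -[X in _ <= _ / X]subr0; apply: slopes; rewrite // lexx.
have hasS : has_ubound S by exists (- G 0 / x).
have S0 : S !=set0 by exists (G 1 / (1 - x)); exists 1 => //=; rewrite x1 lexx.
exists (sup S) => t /andP[t0 t1].
suff : G t <= sup S * (t - x) by rewrite /G; lra.
have [tx|xt|->] := ltgtP t x.
- have : sup S <= - G t / (x - t).
    by apply: ge_sup => // _ [b /= xb1 <-]; apply: slopes => //; rewrite t0.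
  by rewrite ler_pdivlMr ?subr_gt0 //; lra.
- have : G t / (t - x) <= sup S by apply: ub_le_sup => //; exists t => //=; rewrite xt.
  by rewrite ler_pdivrMr ?subr_gt0.
- by rewrite /G !subrr mulr0 expr0n mul0r addr0 mulr1 sub0r oppr_le0.
Qed.

End SupportLine.

(** * Moments of the Bernstein weights *)

Section BinomialWeights.
Variable R : realType.
Implicit Types (x : R) (phi : nat -> R) (n k : nat).

Definition bernstein_mean n x phi : R :=
  \sum_(k < n.+1) phi k * bernstein_basis n k x.

Local Notation p n k x := (bernstein_basis n k x).
Local Notation Em := bernstein_mean.

Lemma bernstein_basis_ge0 n k x : 0 <= x <= 1 -> 0 <= p n k x.
Proof.
by move=> /andP[x0 x1]; rewrite !mulr_ge0 ?exprn_ge0 ?subr_ge0.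
Qed.

Lemma bernstein_basis_small n k x : (n < k)%N -> p n k x = 0.
Proof. by move=> nk; rewrite /bernstein_basis bin_small // !mul0r. Qed.

Lemma bernstein_basisSS n k x :
  p n.+1 k.+1 x = (1 - x) * p n k.+1 x + x * p n k x.
Proof.
rewrite /bernstein_basis binS subSS natrD !mulrDl addrC.
have [kn|nk] := ltnP k n; first by rewrite -(subnSK kn) !exprS; ring.
by rewrite (@bin_small n k.+1) // mulr0n exprS; ring.
Qed.

Lemma bernstein_basisS0 n x : p n.+1 0 x = (1 - x) * p n 0 x.
Proof. by rewrite /bernstein_basis !bin0 !subn0 exprS; ring. Qed.

(** Conditioning on the last of n + 1 Bernoulli trials. *)
Lemma bernstein_mean_rec n x phi :
  Em n.+1 x phi = (1 - x) * Em n x phi + x * Em n x (fun k => phi k.+1).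
Proof.
rewrite /Em big_ord_recl bernstein_basisS0 /=.
under eq_bigr do rewrite /bump /= add1n bernstein_basisSS mulrDr.
rewrite big_split /= addrA; congr (_ + _).
- rewrite big_ord_recr /= (@bernstein_basis_small n n.+1) // !mulr0 addr0.
  rewrite [X in _ = _ * X]big_ord_recl /= mulrDr mulr_sumr mulrCA.
  by congr (_ + _); apply: eq_bigr => i _; rewrite /bump /= add1n mulrCA.
- by rewrite mulr_sumr; apply: eq_bigr => i _; rewrite mulrCA.
Qed.

Lemma bernstein_mean_ext n x phi psi :
  (forall k, (k <= n)%N -> phi k = psi k) -> Em n x phi = Em n x psi.
Proof. by move=> e; apply: eq_bigr => i _; rewrite e // -ltnS. Qed.

Lemma bernstein_meanD n x phi psi :
  Em n x (fun k => phi k + psi k) = Em n x phi + Em n x psi.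
Proof. by rewrite -big_split; apply: eq_bigr => i _; rewrite mulrDl. Qed.

Lemma bernstein_meanZ n x c phi : Em n x (fun k => c * phi k) = c * Em n x phi.
Proof. by rewrite mulr_sumr; apply: eq_bigr => i _; rewrite mulrA. Qed.

Lemma bernstein_mean_cst n x c : Em n x (fun=> c) = c.
Proof.
elim: n => [|n IH]; last by rewrite bernstein_mean_rec IH; ring.
by rewrite /Em big_ord1 /bernstein_basis bin0 !expr0 !mulr1.
Qed.

Lemma bernstein_mean_le n x phi psi : 0 <= x <= 1 ->
  (forall k, (k <= n)%N -> phi k <= psi k) -> Em n x phi <= Em n x psi.
Proof.
move=> x01 le; apply: ler_sum => i _.
by rewrite ler_wpM2r ?bernstein_basis_ge0 // le // -ltnS.
Qed.

Lemma bernstein_mean_ge0 n x phi : 0 <= x <= 1 ->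
  (forall k, (k <= n)%N -> 0 <= phi k) -> 0 <= Em n x phi.
Proof.
move=> x01 phi0; apply: sumr_ge0 => i _.
by rewrite mulr_ge0 ?bernstein_basis_ge0 // phi0 // -ltnS.
Qed.

(** The four identities are proved together since the recursion for one
    moment involves the lower ones; the third is needed for the fourth. *)
Lemma bernstein_central_moments n x (z := fun k => k%:R - n%:R * x : R) :
  [/\ Em n x z = 0,
      Em n x (fun k => z k ^+ 2) = n%:R * (x * (1 - x)),
      Em n x (fun k => z k ^+ 3) = n%:R * (x * (1 - x)) * (1 - 2 * x) &
      Em n x (fun k => z k ^+ 4) =
        n%:R * (x * (1 - x)) * (1 + 3 * (n%:R - 2) * (x * (1 - x)))].
Proof.
rewrite {}/z; elim: n => [|n [H1 H2 H3 H4]].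
  by rewrite /Em !big_ord1 /= !mul0r subrr !expr0n /= !mul0r.
pose z (k : nat) : R := k%:R - n%:R * x.
have I1 : Em n x z = 0 := H1.
have I2 : Em n x (fun k => z k ^+ 2) = n%:R * (x * (1 - x)) := H2.
have I3 : Em n x (fun k => z k ^+ 3) = n%:R * (x * (1 - x)) * (1 - 2 * x) := H3.
have I4 : Em n x (fun k => z k ^+ 4) =
    n%:R * (x * (1 - x)) * (1 + 3 * (n%:R - 2) * (x * (1 - x))) := H4.
have z1 k : k.+1%:R - n.+1%:R * x = z k + (1 - x) by rewrite /z -!natr1; ring.
have z0 k : k%:R - n.+1%:R * x = z k - x by rewrite /z -natr1; ring.
have E1 c : Em n x (fun k => z k + c) = c.
  by rewrite bernstein_meanD bernstein_mean_cst I1 add0r.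
have E2 c : Em n x (fun k => (z k + c) ^+ 2) = n%:R * (x * (1 - x)) + c ^+ 2.
  rewrite (@bernstein_mean_ext _ _ _ (fun k => z k ^+ 2 + (2 * c * z k + c ^+ 2))).
    by rewrite !bernstein_meanD bernstein_meanZ bernstein_mean_cst I1 I2; ring.
  by move=> k _; ring.
have E3 c : Em n x (fun k => (z k + c) ^+ 3) = n%:R * (x * (1 - x)) * (1 - 2 * x)
    + 3 * c * (n%:R * (x * (1 - x))) + c ^+ 3.
  rewrite (@bernstein_mean_ext _ _ _
    (fun k => z k ^+ 3 + (3 * c * z k ^+ 2 + (3 * c ^+ 2 * z k + c ^+ 3)))).
    by rewrite !bernstein_meanD !bernstein_meanZ bernstein_mean_cst I1 I2 I3; ring.
  by move=> k _; ring.
have E4 c : Em n x (fun k => (z k + c) ^+ 4) =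
    n%:R * (x * (1 - x)) * (1 + 3 * (n%:R - 2) * (x * (1 - x)))
    + 4 * c * (n%:R * (x * (1 - x)) * (1 - 2 * x))
    + 6 * c ^+ 2 * (n%:R * (x * (1 - x))) + c ^+ 4.
  rewrite (@bernstein_mean_ext _ _ _ (fun k => z k ^+ 4 + (4 * c * z k ^+ 3
     + (6 * c ^+ 2 * z k ^+ 2 + (4 * c ^+ 3 * z k + c ^+ 4))))).
    by rewrite !bernstein_meanD !bernstein_meanZ bernstein_mean_cst I1 I2 I3 I4; ring.
  by move=> k _; ring.
have step r : Em n.+1 x (fun k => (k%:R - n.+1%:R * x) ^+ r) =
    (1 - x) * Em n x (fun k => (z k - x) ^+ r) + x * Em n x (fun k => (z k + (1 - x)) ^+ r).
  rewrite bernstein_mean_rec; congr (_ * _ + _ * _); apply: bernstein_mean_ext => k _.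
    by rewrite z0.
  by rewrite z1.
split.
- by have := step 1%N; rewrite !E1 /= => ->; ring.
- by rewrite step !E2 -natr1; ring.
- by rewrite step !E3 -natr1; ring.
- by rewrite step !E4 -natr1; ring.
Qed.

Lemma bernstein_basis_ratio n k x : (k <= n)%N ->
  k.+1%:R * (1 - x) * p n k.+1 x = (n%:R - k%:R) * x * p n k x.
Proof.
rewrite leq_eqVlt => /orP[/eqP->|kn].
  by rewrite bernstein_basis_small // subrr mulr0 !mul0r.
rewrite /bernstein_basis -(subnSK kn) !exprS.
have := congr1 (fun m => m%:R : R) (mul_bin_left n k).
rewrite !natrM natrB 1?ltnW // => e.
rewrite [LHS](_ : _ = k.+1%:R * 'C(n, k.+1)%:R * (1 - x) * x * x ^+ k * (1 - x) ^+ (n - k.+1)).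
  by rewrite e; ring.
by ring.
Qed.

(** The sum telescopes (de Moivre): each new term is the difference of two
    consecutive right-hand sides, by the ratio of consecutive weights. *)
Lemma bernstein_deficit n k x : (k <= n)%N ->
  \sum_(i < k.+1) (n%:R * x - i%:R) * p n i x = (n%:R - k%:R) * x * p n k x.
Proof.
elim: k => [|k IH] kn; first by rewrite big_ord1 /= !subr0.
rewrite big_ord_recr /= IH 1?ltnW // -bernstein_basis_ratio 1?ltnW // -natr1.
by ring.
Qed.

(** Factorial moments of the binomial law; this is why the operator
    reproduces the monomial of degree j. *)
Lemma bernstein_mean_ffact n j x :
  Em n x (fun k => (k ^_ j)%:R) = (n ^_ j)%:R * x ^+ j.
Proof.
elim: j n => [|j IH] n.
  rewrite ffactn0 mul1r expr0 -[RHS](bernstein_mean_cst n x).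
  by apply: bernstein_mean_ext => k _; rewrite ffactn0.
case: n => [|n].
  by rewrite /Em big_ord1 /= !ffact0n /= !mul0r.
rewrite ffactnS /= natrM exprS -[RHS]mulrA [_ * (x * _)]mulrCA -IH /Em.
rewrite big_ord_recl ffact0n /= mul0r add0r !mulr_sumr; apply: eq_bigr => i _.
rewrite /bump /= add1n ffactnS /= natrM /bernstein_basis subSS exprS.
have := congr1 (fun m => m%:R : R) (mul_bin_diag n.+1 i); rewrite !natrM => e.
rewrite [LHS](_ : _ = i.+1%:R * 'C(n.+1, i.+1)%:R * (i ^_ j)%:R * x * x ^+ i * (1 - x) ^+ (n - i)).
  by rewrite -e; ring.
by ring.
Qed.

End BinomialWeights.

(** * Location of the nodes *)

Section Nodes.
Variable R : realType.
Implicit Types (x c : R) (n j k : nat).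

Local Notation node := (akr_node R).

Lemma akr_node_ge0 n j k : 0 <= node n j k.
Proof. exact: powR_ge0. Qed.

Lemma akr_node_exp n j k : (0 < j)%N ->
  node n j k ^+ j = (k ^_ j)%:R / (n ^_ j)%:R.
Proof.
move=> j0; rewrite -powR_mulrn ?akr_node_ge0 // /akr_node -powRrM mulVf.
  by rewrite powRr1 // divr_ge0.
by rewrite pnatr_eq0 -lt0n.
Qed.

Lemma akr_node_ge n j k c : (0 < j <= n)%N -> 0 <= c ->
  c ^+ j * (n ^_ j)%:R <= (k ^_ j)%:R -> c <= node n j k.
Proof.
move=> /andP[j0 jn] c0 le.
rewrite -(ler_pXn2r j0) ?nnegrE ?akr_node_ge0 // akr_node_exp //.
by rewrite ler_pdivlMr // ltr0n ffact_gt0.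
Qed.

Lemma akr_node_le n j k c : (0 < j <= n)%N -> 0 <= c ->
  (k ^_ j)%:R <= c ^+ j * (n ^_ j)%:R -> node n j k <= c.
Proof.
move=> /andP[j0 jn] c0 le.
rewrite -(ler_pXn2r j0) ?nnegrE ?akr_node_ge0 // akr_node_exp //.
by rewrite ler_pdivrMr // ltr0n ffact_gt0.
Qed.

Lemma ffact_le_exp n j : (n ^_ j <= n ^ j)%N.
Proof.
elim: j => [|j IH]; first by rewrite ffactn0.
by rewrite ffactnSr expnSr leq_mul ?leq_subr.
Qed.

Lemma ffact_ratio_le n j k : (k <= n)%N -> (n ^ j * k ^_ j <= k ^ j * n ^_ j)%N.
Proof.
move=> kn; elim: j => [|j IH]; first by rewrite !ffactn0.
rewrite !ffactnSr !expnSr mulnACA [leqRHS]mulnACA leq_mul // !mulnBr mulnC leq_sub2l //.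
by rewrite leq_mul2r kn orbT.
Qed.

Lemma exp_le_ffact k j : ((k.+1 - j) ^ j <= k ^_ j)%N.
Proof.
elim: j k => [|j IH] k; first by rewrite ffactn0.
case: k => [|k]; first by rewrite subSS sub0n exp0n.
by rewrite ffactnS expnS /= subSS leq_mul ?leq_subr ?IH.
Qed.

(** With a = k - j the right side is (a + 1) ... (a + j).  For j = 3 this is
    the inequality of the means with some loss, and each further factor exceeds
    a + 8 / 5. *)
Lemma shifted_exp_le_ffact k j : (3 <= j <= k)%N ->
  (k%:R - j%:R + 1 + 3 / 5) ^+ j <= (k ^_ j)%:R :> R.
Proof.
case: j => [|[|[|j]]] // /andP[_ jk].
rewrite -(subnK jk); move: (k - j.+3)%N => a {k jk}.
rewrite natrD addrK; elim: j => [|j IH].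
  rewrite addn3 !ffactnS ffactn0 /= muln1 !natrM -[a.+3]addn3 -[a.+2]addn2 -[a.+1]addn1 !natrD.
  have : 0 <= a%:R :> R by [].
  by move: (a%:R) => b b0; nra.
have a0 : 0 <= a%:R + 1 + 3 / 5 :> R by have : 0 <= a%:R :> R by []; lra.
rewrite addnS ffactnS /= natrM exprS; apply: (ler_pM a0 _ _ IH); first exact: exprn_ge0.
by rewrite -[(a + j.+3).+1]addn1 -[j.+3]addn3 !natrD; have : 0 <= j%:R :> R by []; lra.
Qed.

Lemma scaled_node_le n j k : (0 < j <= n)%N -> (k <= n)%N ->
  n%:R * node n j k <= k%:R.
Proof.
move=> /andP[j0 jn] kn; have n0 : 0 < n%:R :> R by rewrite ltr0n (leq_trans j0).
rewrite mulrC -ler_pdivlMr //; apply: akr_node_le; rewrite ?j0 ?divr_ge0 //.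
rewrite expr_div_n mulrAC ler_pdivlMr ?exprn_gt0 // -!natrX -!natrM ler_nat.
by rewrite mulnC ffact_ratio_le.
Qed.

Lemma scaled_node_ge n j k c : (0 < j <= n)%N -> 0 <= c ->
  c ^+ j <= (k ^_ j)%:R -> c <= n%:R * node n j k.
Proof.
move=> /andP[j0 jn] c0 le; have n0 : 0 < n%:R :> R by rewrite ltr0n (leq_trans j0).
rewrite mulrC -ler_pdivrMr //; apply: akr_node_ge; rewrite ?j0 ?divr_ge0 ?ler0n //.
rewrite expr_div_n mulrAC ler_pdivrMr ?exprn_gt0 //.
by rewrite ler_pM ?exprn_ge0 // -natrX ler_nat ffact_le_exp.
Qed.

(** Together with [scaled_node_le], this lets node k be replaced by k / n
    within the range allowed by the first modulus. *)
Lemma scaled_node_ge_sub n j k : (0 < j <= n)%N ->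
  k%:R - (j%:R - 1) <= n%:R * node n j k.
Proof.
move=> jn; have [jk|kj] := leqP j k.+1.
  have -> : k%:R - (j%:R - 1) = (k.+1 - j)%:R :> R by rewrite natrB // -natr1; ring.
  by apply: scaled_node_ge => //; rewrite -natrX ler_nat exp_le_ffact.
apply: (@le_trans _ _ 0); last by rewrite mulr_ge0 ?akr_node_ge0.
by rewrite subr_le0 lerBrDr natr1 ler_nat ltnW.
Qed.

Lemma scaled_node_small n j k : (k < j <= n)%N -> n%:R * node n j k = 0.
Proof.
move=> /andP[kj jn]; have j0 : (0 < j)%N by apply: leq_trans kj.
have : node n j k ^+ j == 0 by rewrite akr_node_exp // ffact_small // mul0r.
by rewrite expf_eq0 j0 => /eqP ->; rewrite mulr0.
Qed.

(** Upward moves are the scarce ones: this and the next two lemmas tell how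
    far beyond k the point attached to node k may be pushed. *)
Lemma scaled_node_room3 n j k : (3 <= j <= k)%N -> (j <= n)%N ->
  k%:R + 3 / 5 <= n%:R * node n j k + (j%:R - 1).
Proof.
move=> jk jn; have j0 : (0 < j <= n)%N by move/andP: jk => [j3 _]; rewrite (leq_trans _ j3).
suff : k%:R - j%:R + 1 + 3 / 5 <= n%:R * node n j k by lra.
apply: scaled_node_ge => //; last exact: shifted_exp_le_ffact.
have : j%:R <= k%:R :> R by rewrite ler_nat; case/andP: jk.
by lra.
Qed.

Lemma scaled_node_room2 n k : (2 <= k)%N -> (2 <= n)%N ->
  k%:R + 2 / 5 <= n%:R * node n 2 k + (2%:R - 1).
Proof.
move=> k2 n2; suff : k%:R - 3 / 5 <= n%:R * node n 2 k by lra.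
have k2' : 2 <= k%:R :> R by rewrite ler_nat.
apply: scaled_node_ge => //; first by lra.
rewrite ffactnS ffactn1 natrM -subn1 natrB; last by apply: leq_trans k2.
by move: (k%:R) k2' => z; nra.
Qed.

(** For j = 2 the scaled node is the square root of k (k - 1) n / (n - 1), and
    the factor n / (n - 1) raises the room to 1 / 2 unless n is large compared
    with k^2. *)
Lemma scaled_node_room2_half n k : (2 <= n)%N -> (0 < k)%N ->
  (n.-1 <= 4 * (k * k.-1))%N ->
  k%:R + 1 / 2 <= n%:R * node n 2 k + (2%:R - 1).
Proof.
move=> n2 k0 nk; suff : k%:R - 1 / 2 <= n%:R * node n 2 k by lra.
have n0 : 0 < n%:R :> R by rewrite ltr0n (leq_trans _ n2).
have k1 : 1 <= k%:R :> R by rewrite ler1n.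
have n2' : 2 <= n%:R :> R by rewrite ler_nat.
suff le : (k%:R - 1 / 2) / n%:R <= node n 2 k.
  by move: le; rewrite ler_pdivrMr // [_ * n%:R]mulrC.
apply: akr_node_ge => //; first by rewrite divr_ge0 //; lra.
have : (n.-1)%:R <= (4 * (k * k.-1))%:R :> R by rewrite ler_nat.
rewrite !ffactnS !ffactn0 !muln1 !natrM -!subn1 !natrB ?(leq_trans _ n2) // expr_div_n.
move=> le'; rewrite mulrAC ler_pdivrMr ?exprn_gt0 //.
rewrite expr2 [leRHS]mulrC -[leRHS]mulrA [leLHS]mulrCA ler_pM2l //.
by move: (k%:R) (n%:R) k1 n2' n0 le' => z u; nra.
Qed.

End Nodes.

(** * Reduction to a transport of the Bernstein weights *)

Section Transport.
Variable R : realType.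
Implicit Types (g q : R -> R) (x W om : R) (n j k r : nat) (w sg vs : nat -> R).

Local Notation node := (akr_node R).
Local Notation p n k x := (bernstein_basis n k x).

(** The condition for [s / n] to be exchangeable with node k at the cost of one
    first modulus with step (j - 1) / n. *)
Definition reachable n j k (s : R) : Prop :=
  0 <= s <= n%:R /\ `|s - n%:R * node n j k| <= j%:R - 1.

(** The moment of order r about the mean when the part [w k] of the k-th weight
    is placed at [sg k] and the remaining part at [vs k]. *)
Definition spread n x w sg vs r : R :=
  \sum_(k < n.+1) (w k * (sg k - n%:R * x) ^+ r
                   + (p n k x - w k) * (vs k - n%:R * x) ^+ r).

(** All that is used of the slack between a function and its parabola, [y]
    being the point of contact. *)
Definition pairwise_large n y W q : Prop :=
  q y = W /\ forall u, 0 <= u -> u ^+ 2 <= n%:R -> 0 <= y - u -> y + u <= n%:R ->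
    W * (1 + u ^+ 2 / n%:R) <= q (y + u) + q (y - u).

(** The part [w] is the mass that exploits the slack: what it gains must cover
    the second moment of the whole configuration.  [up] says on which side of
    the point the mean has to end. *)
Definition transportable n j x (up : bool) : Prop :=
  exists w sg vs,
    [/\ forall k, (k <= n)%N ->
          [/\ 0 <= w k <= p n k x, reachable n j k (sg k) & reachable n j k (vs k)],
        (if up then 0 <= spread n x w sg vs 1 else spread n x w sg vs 1 <= 0) &
        forall W q, 0 <= W -> pairwise_large n (n%:R * x) W q ->
          W * spread n x w sg vs 2
            <= 2 * n%:R * \sum_(k < n.+1) w k * q (sg k)].

(** Integrate the parabola of [quadratic_majorant] over the transported
    weights: the linear term has the right sign by the choice of [up] from the
    sign of the slope, and the quadratic term is cancelled by the slack
    collected at the mass [w]. *)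
Lemma transport_bound g W om n j x :
  {within `[0, 1], continuous g} -> 0 <= W ->
  (forall u t, 0 <= t -> n%:R * t ^+ 2 <= 1 -> 0 <= u - t -> u + t <= 1 ->
     `|g (u + t) - 2 * g u + g (u - t)| <= W) ->
  (forall u v, 0 <= u <= 1 -> 0 <= v <= 1 -> `|u - v| <= (j%:R - 1) / n%:R ->
     `|g u - g v| <= om) ->
  0 < x < 1 -> (0 < j <= n)%N ->
  transportable n j x true -> transportable n j x false ->
  akr_operator n j g x - g x <= W + om.
Proof.
move=> gc W0 gW gD1 x01 jn up down.
have n0 : 0 < n%:R :> R by rewrite ltr0n; case/andP: jn => [j0]; apply: leq_trans.
have n1 : n%:R != 0 :> R by rewrite gt_eqF.
pose h : R := (Num.sqrt n%:R)^-1.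
have h0 : 0 < h by rewrite invr_gt0 sqrtr_gt0.
have hh : h ^+ 2 = n%:R^-1 by rewrite exprVn sqr_sqrtr // ltW.
have gWh u t : 0 <= t <= h -> 0 <= u - t -> u + t <= 1 ->
    `|g (u + t) - 2 * g u + g (u - t)| <= W.
  move=> /andP[t0 th]; apply: gW => //.
  have : t ^+ 2 <= h ^+ 2 by rewrite ler_sqr ?nnegrE // ltW.
  by rewrite hh -(ler_pM2l n0) divff.
have [m mP] := quadratic_majorant h0 W0 gc gWh x01.
pose y := n%:R * x.
pose q S := W * (1 + (S - y) ^+ 2 / (2 * n%:R)) + g x + m * ((S - y) / n%:R)
  - g (S / n%:R).
have qge0 S : 0 <= S <= n%:R -> 0 <= q S.
  move=> /andP[S0 Sn]; have /mP : 0 <= S / n%:R <= 1.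
    by rewrite divr_ge0 ?(ltW n0) //= ler_pdivrMr // mul1r.
  rewrite hh [S / n%:R - x](_ : _ = (S - y) / n%:R); last by rewrite /y; field.
  rewrite [_ ^+ 2 / _](_ : _ = (S - y) ^+ 2 / (2 * n%:R)); last by field.
  by rewrite /q; lra.
have qy : pairwise_large n y W q.
  split; first by rewrite /q subrr expr0n /= !mul0r mulr0 !addr0 mulr1 /y mulrC mulKf // addrK.
  move=> u u0 un yu uy.
  have := gWh x (u / n%:R).
  have -> : x + u / n%:R = (y + u) / n%:R by rewrite /y; field.
  have -> : x - u / n%:R = (y - u) / n%:R by rewrite /y; field.
  have uh : 0 <= u / n%:R <= h.
    rewrite divr_ge0 ?(ltW n0) //= -ler_sqr ?nnegrE ?divr_ge0 ?(ltW n0) ?(ltW h0) //.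
    rewrite hh expr_div_n ler_pdivrMr ?exprn_gt0 //.
    by rewrite expr2 mulrA mulVf // mul1r.
  move/(_ uh); rewrite divr_ge0 ?(ltW n0) // ler_pdivrMr // mul1r => /(_ isT uy).
  rewrite ler_norml => /andP[_ D].
  rewrite /q [y + u - y](_ : _ = u); last by ring.
  rewrite [y - u - y](_ : _ = - u); last by ring.
  rewrite -subr_ge0 in D; rewrite -subr_ge0.
  apply: le_trans D _; rewrite le_eqVlt; apply/orP; left; apply/eqP.
  by field.
have [w [sg [vs [wP mom gain]]]] : transportable n j x (m < 0) by case: (m < 0).
have {}mom : m * spread n x w sg vs 1 <= 0.
  move: mom; case: ifPn => [m0 s0|]; first by rewrite nmulr_rle0.
  by rewrite -leNgt => m0 s0; rewrite mulr_ge0_le0.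
have {}gain := gain W q W0 qy.
have x01' : 0 <= x <= 1 by case/andP: x01 => [/ltW -> /ltW ->].
have move1 k s : (k <= n)%N -> reachable n j k s ->
    g (node n j k) <= g (s / n%:R) + om.
  move=> kn [/andP[s0 sn] sd].
  rewrite -lerBlDl; apply: le_trans (ler_norm _) _; apply: gD1.
  - rewrite akr_node_ge0 /= -(ler_pM2l n0) mulr1.
    by apply: le_trans (scaled_node_le _ jn kn) _; rewrite ler_nat.
  - by rewrite divr_ge0 ?(ltW n0) //= ler_pdivrMr // mul1r.
  - have -> : node n j k - s / n%:R = (n%:R * node n j k - s) / n%:R by field.
    by rewrite normrM normfV (gtr0_norm n0) ler_pM2r ?invr_gt0 // distrC.
have : akr_operator n j g x <= \sum_(k < n.+1)
    (w k * (g (sg k / n%:R) + om) + (p n k x - w k) * (g (vs k / n%:R) + om)).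
  apply: ler_sum => k _; have kn : (k <= n)%N by rewrite -ltnS.
  have [/andP[w0 wp] rs rv] := wP k kn.
  rewrite -[X in _ * X](subrKC (w k)) mulrDr.
  by apply: lerD; rewrite mulrC ler_wpM2l ?subr_ge0 ?move1.
have -> : \sum_(k < n.+1) (w k * (g (sg k / n%:R) + om)
      + (p n k x - w k) * (g (vs k / n%:R) + om))
    = (W + g x + om) + (m / n%:R) * spread n x w sg vs 1
      + (W * spread n x w sg vs 2 / (2 * n%:R))
      - \sum_(k < n.+1) w k * q (sg k)
      - \sum_(k < n.+1) (p n k x - w k) * q (vs k).
  rewrite [W * _ / _]mulrAC -[X in _ = X + _ + _ - _ - _](bernstein_mean_cst n x).
  rewrite /spread /bernstein_mean !mulr_sumr -!big_split -!sumrB /=.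
  by apply: eq_bigr => k _; rewrite /q !expr1 -/y; field.
have : 0 <= \sum_(k < n.+1) (p n k x - w k) * q (vs k).
  apply: sumr_ge0 => k _; have kn : (k <= n)%N by rewrite -ltnS.
  have [/andP[w0 wp] _ [rv _]] := wP k kn.
  by apply: mulr_ge0; [rewrite subr_ge0|exact: qge0].
have : W * spread n x w sg vs 2 / (2 * n%:R) <= \sum_(k < n.+1) w k * q (sg k).
  by rewrite ler_pdivrMr ?mulr_gt0 // [leRHS]mulrC.
have : m / n%:R * spread n x w sg vs 1 <= 0.
  by rewrite mulrAC pmulr_lle0 ?invr_gt0.
lra.
Qed.

End Transport.

(** * The mean absolute deviation *)

Section MeanDeviation.
Variable R : realType.
Implicit Types (x : R) (n k : nat).

Local Notation p n k x := (bernstein_basis n k x).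
Local Notation Em := (@bernstein_mean R).

Definition mean_deviation n x : R := Em n x (fun k => `|k%:R - n%:R * x|).

(** De Moivre: the deviation is twice the total deficit below the mean. *)
Lemma mean_deviationE n k x : (k <= n)%N -> k%:R <= n%:R * x <= k.+1%:R ->
  mean_deviation n x = 2 * ((n%:R - k%:R) * x * p n k x).
Proof.
move=> kn /andP[ky yk].
have [M1 _ _ _] := bernstein_central_moments n x.
have -> : mean_deviation n x =
    Em n x (fun k => `|k%:R - n%:R * x| + - 1 * (k%:R - n%:R * x)).
  by rewrite bernstein_meanD bernstein_meanZ M1 mulr0 addr0.
rewrite -bernstein_deficit // /bernstein_mean.
rewrite (big_ord_widen n.+1 (fun i => (n%:R * x - i%:R) * p n i x)) //.
rewrite mulr_sumr [RHS]big_mkcond /=; apply: eq_bigr => i _.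
have [ik|ki] := ltnP i k.+1.
  have : i%:R <= n%:R * x by apply: le_trans ky; rewrite ler_nat.
  by move=> iy; rewrite ler0_norm ?subr_le0 //; ring.
have : n%:R * x <= i%:R by apply: le_trans yk _; rewrite ler_nat.
by move=> iy; rewrite ger0_norm ?subr_ge0 // mulN1r subrr mul0r.
Qed.

Lemma mean_deviation_succE n k x : (k <= n)%N -> k%:R <= n%:R * x <= k.+1%:R ->
  mean_deviation n x = 2 * (k.+1%:R * (1 - x) * p n k.+1 x).
Proof. by move=> kn ky; rewrite bernstein_basis_ratio // (mean_deviationE kn ky). Qed.

(** For t >= 0, t >= 3 t^2 / (2 c) - t^4 / (2 c^3), with contact at t = c;
    average this over t = |k - y|. *)
Lemma mean_deviation_ge n x c : 0 <= x <= 1 -> 0 < c ->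
  1 + 3 * (n%:R - 2) * (x * (1 - x)) <= c ^+ 2 ->
  n%:R * (x * (1 - x)) / c <= mean_deviation n x.
Proof.
move=> x01 c0 cge; have [_ M2 _ M4] := bernstein_central_moments n x.
set s := x * (1 - x) in cge M2 M4 *.
have V0 : 0 <= n%:R * s by case/andP: x01 => x0 x1; rewrite !mulr_ge0 ?subr_ge0.
have c1 : c != 0 by rewrite gt_eqF.
pose z k : R := k%:R - n%:R * x.
apply: (@le_trans _ _ (Em n x (fun k => 3 / (2 * c) * z k ^+ 2
    + - (2 * c ^+ 3)^-1 * z k ^+ 4))); last first.
  apply: bernstein_mean_le => // k _; rewrite -/(z k).
  rewrite [z k ^+ 4](exprM _ 2 2) -(real_normK (num_real (z k))) -exprM.
  move: (normr_ge0 (z k)); move: (`|z k|) => t t0.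
  rewrite -subr_ge0.
  have -> : t - (3 / (2 * c) * t ^+ 2 + - (2 * c ^+ 3)^-1 * t ^+ 4)
    = t * (t - c) ^+ 2 * (t + 2 * c) / (2 * c ^+ 3) by field.
  apply: divr_ge0; last by rewrite mulr_ge0 // exprn_ge0 // ltW.
  by apply: mulr_ge0; [rewrite mulr_ge0 ?sqr_ge0|lra].
rewrite bernstein_meanD !bernstein_meanZ M2 M4.
have -> : 3 / (2 * c) * (n%:R * s) + - (2 * c ^+ 3)^-1 * (n%:R * s * (1 + 3 * (n%:R - 2) * s))
  = n%:R * s / c + n%:R * s * (c ^+ 2 - (1 + 3 * (n%:R - 2) * s)) / (2 * c ^+ 3) by field.
rewrite lerDl; apply: divr_ge0; last by rewrite mulr_ge0 // exprn_ge0 // ltW.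
by rewrite mulr_ge0 // subr_ge0.
Qed.

(** The variance of the absolute deviation is nonnegative. *)
Lemma mean_deviation_le n x : 0 <= x <= 1 ->
  mean_deviation n x <= Num.sqrt (n%:R * (x * (1 - x))).
Proof.
move=> x01; have [_ M2 _ _] := bernstein_central_moments n x.
set V := n%:R * (x * (1 - x)) in M2 *.
have V0 : 0 <= V by case/andP: x01 => x0 x1; rewrite !mulr_ge0 ?subr_ge0.
have D0 : 0 <= mean_deviation n x.
  by apply: bernstein_mean_ge0 => // k _; exact: normr_ge0.
rewrite -ler_sqr ?nnegrE ?sqrtr_ge0 // sqr_sqrtr // -subr_ge0.
set D := mean_deviation n x.
have : 0 <= Em n x (fun k => (`|k%:R - n%:R * x| - D) ^+ 2).
  by apply: bernstein_mean_ge0 => // k _; exact: sqr_ge0.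
rewrite (@bernstein_mean_ext _ _ _ _ (fun k => (k%:R - n%:R * x) ^+ 2
   + (- 2 * D * `|k%:R - n%:R * x| + D ^+ 2))); last first.
  by move=> k _; rewrite -(real_normK (num_real (k%:R - n%:R * x))); ring.
rewrite bernstein_meanD bernstein_meanD bernstein_meanZ bernstein_mean_cst M2.
by rewrite -/(mean_deviation n x) -/D; lra.
Qed.

(** This says that c = n / (1 + (n - 1) s) is admissible in
    [mean_deviation_ge]; it is the origin of the threshold for n s^3. *)
Lemma central_regime_ineq (N s : R) : 2 <= N -> 0 <= s <= 1 / 4 ->
  N * s ^+ 3 <= 23 / 100 ->
  (1 + 3 * (N - 2) * s) * (1 + (N - 1) * s) ^+ 2 <= N ^+ 2.
Proof.
move=> N2 /andP[s0 s4] Ns.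
(* Up to N = 15 the bound s <= 1 / 4 suffices; beyond, the cubic term is
   3 N^2 (N s^3) and the other terms are bounded one by one. *)
have [N15|N15] := leP N 15.
  apply: (@le_trans _ _ ((1 + 3 * (N - 2) * (1 / 4)) * (1 + (N - 1) * (1 / 4)) ^+ 2)).
    have a1 : (N - 2) * s <= (N - 2) * (1 / 4) by rewrite ler_wpM2l //; lra.
    have a2 : (N - 1) * s <= (N - 1) * (1 / 4) by rewrite ler_wpM2l //; lra.
    have a3 : 0 <= (N - 2) * s by rewrite mulr_ge0 //; lra.
    have a4 : 0 <= (N - 1) * s by rewrite mulr_ge0 //; lra.
    by apply: ler_pM; rewrite ?exprn_ge0 ?ler_sqr ?nnegrE //; lra.
  have [N3|N3] := leP N 3; nra.
have b1 : N ^+ 3 * s ^+ 3 <= N ^+ 2 * (23 / 100).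
  rewrite (_ : N ^+ 3 * s ^+ 3 = N ^+ 2 * (N * s ^+ 3)); last by ring.
  by rewrite ler_wpM2l ?sqr_ge0.
have b2 : N ^+ 2 * (s ^+ 2 * (7 - 12 * s)) <= N ^+ 2 * (1 / 4).
  rewrite ler_wpM2l ?sqr_ge0 //.
  have : s * (1 / 4 - s) >= 0 by rewrite mulr_ge0 //; lra.
  nra.
have b3 : N * (s * (5 - 20 * s + 15 * s ^+ 2)) <= N * (2 / 5).
  rewrite ler_wpM2l //; first by lra.
  have : s * (1 / 4 - s) >= 0 by rewrite mulr_ge0 //; lra.
  have : 0 <= (s - 3 / 20) ^+ 2 by exact: sqr_ge0.
  nra.
have b4 : (1 - 6 * s) * (1 - s) ^+ 2 <= 1.
  have : s * (1 / 4 - s) >= 0 by rewrite mulr_ge0 //; lra.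
  nra.
have -> : (1 + 3 * (N - 2) * s) * (1 + (N - 1) * s) ^+ 2 =
  3 * (N ^+ 3 * s ^+ 3) + N ^+ 2 * (s ^+ 2 * (7 - 12 * s))
  + N * (s * (5 - 20 * s + 15 * s ^+ 2)) + (1 - 6 * s) * (1 - s) ^+ 2 by ring.
nra.
Qed.

Lemma variance_le_quarter x : x * (1 - x) <= 1 / 4.
Proof. by rewrite -subr_ge0 (_ : _ - _ = (x - 1 / 2) ^+ 2) ?sqr_ge0 //; field. Qed.

Lemma mean_deviation_central n x : (2 <= n)%N -> 0 < x < 1 ->
  n%:R * (x * (1 - x)) ^+ 3 <= 23 / 100 ->
  x * (1 - x) * (1 + (n%:R - 1) * (x * (1 - x))) <= mean_deviation n x.
Proof.
move=> n2 /andP[x0 x1] ns.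
have N2 : 2 <= n%:R :> R by rewrite ler_nat.
have s0 : 0 < x * (1 - x) by rewrite mulr_gt0 ?subr_gt0.
have := central_regime_ineq N2 (_ : 0 <= x * (1 - x) <= 1 / 4) ns.
rewrite (ltW s0) variance_le_quarter => /(_ isT).
set s := x * (1 - x) in s0 ns *; set b := 1 + (n%:R - 1) * s => ineq.
have b0 : 0 < b by rewrite /b ltr_wpDr // mulr_ge0 ?(ltW s0) //; lra.
have n0 : 0 < n%:R :> R by lra.
have := @mean_deviation_ge n x (n%:R / b).
rewrite (ltW x0) (ltW x1) divr_gt0 // => /(_ isT isT).
rewrite expr_div_n ler_pdivlMr ?exprn_gt0 // => /(_ ineq).
by rewrite -/s [leLHS](_ : _ = s * b) //; field; rewrite !gt_eqF.
Qed.

End MeanDeviation.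

(** * Small n s^3: an atom at the mean *)

Section Atom.
Variable R : realType.
Implicit Types (x s : R) (n j k a : nat) (vs : nat -> R).

Local Notation node := (akr_node R).
Local Notation p n k x := (bernstein_basis n k x).

Lemma reachable_range n j k s : (1 < j <= n)%N -> (k <= n)%N ->
  0 <= s <= n%:R -> k%:R - 1 <= s -> s <= n%:R * node n j k + (j%:R - 1) ->
  reachable n j k s.
Proof.
move=> /andP[j1 jn] kn s0n ks sT; split => //.
have j2 : 2 <= j%:R :> R by rewrite ler_nat.
have Tk : n%:R * node n j k <= k%:R by rewrite scaled_node_le // (ltnW j1).
by rewrite ler_norml; apply/andP; split; lra.
Qed.

Lemma reachable_id n j k : (1 < j <= n)%N -> (k <= n)%N ->
  reachable n j k (k%:R : R).
Proof.
move=> jn kn; apply: reachable_range => //.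
- by rewrite ler0n ler_nat.
- by lra.
- rewrite -lerBlDr scaled_node_ge_sub //.
  by case/andP: jn => /ltnW -> ->.
Qed.

Lemma reachable_lower n j k s : (1 < j <= n)%N -> (k <= n)%N ->
  0 <= s -> k%:R - 1 <= s <= k%:R -> reachable n j k s.
Proof.
move=> jn kn s0 /andP[ks sk]; apply: reachable_range => //.
- by rewrite s0 (le_trans sk) ?ler_nat.
- apply: le_trans sk _; rewrite -lerBlDr scaled_node_ge_sub //.
  by case/andP: jn => /ltnW -> ->.
Qed.

Lemma sum_at n a (F : nat -> R) : (a <= n)%N ->
  \sum_(k < n.+1) (if k == a :> nat then F k else 0) = F a.
Proof. by move=> an; rewrite -big_mkcond big_ord1_eq ltnS an. Qed.

(** A mass s / 2 of weight [a] is put at the mean.  It gains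
    2 n (s / 2) W = n s W, exactly the second moment of the original weights,
    and moving the rest towards the mean only lowers that moment. *)
Lemma atom_transport n j x up a vs : 0 < x < 1 -> (1 < j <= n)%N -> (a <= n)%N ->
  x * (1 - x) / 2 <= p n a x -> reachable n j a (n%:R * x) ->
  (forall k, (k <= n)%N -> reachable n j k (vs k)) ->
  (forall k, (k <= n)%N -> (vs k - n%:R * x) ^+ 2 <= (k%:R - n%:R * x) ^+ 2) ->
  (let excess := bernstein_mean n x (fun k => vs k - n%:R * x)
                 - x * (1 - x) / 2 * (vs a - n%:R * x) in
   if up then 0 <= excess else excess <= 0) ->
  transportable n j x up.
Proof.
move=> x01 jn an pa ra rv vle; set y := n%:R * x in ra vle *.
have x01' : 0 <= x <= 1 by case/andP: x01 => /ltW -> /ltW ->.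
set s := x * (1 - x) in pa *; move=> /= mom.
have s0 : 0 < s by case/andP: x01 => x0 x1; rewrite mulr_gt0 ?subr_gt0.
pose w k := if k == a then s / 2 else 0.
pose sg k := if k == a then y else vs k.
have spr (F : R -> R) : \sum_(k < n.+1) (w k * F (sg k) + (p n k x - w k) * F (vs k))
    = bernstein_mean n x (fun k => F (vs k)) + s / 2 * (F y - F (vs a)).
  rewrite /bernstein_mean -(sum_at (fun k => s / 2 * (F y - F (vs k))) an) -big_split.
  apply: eq_bigr => k _ /=; rewrite /w /sg; case: ifP => [/eqP ->|_]; ring.
exists w, sg, vs; split.
- move=> k kn; split; last exact: rv.
    rewrite /w; case: ifP => [/eqP ->|_]; last by rewrite lexx bernstein_basis_ge0.
    by rewrite pa andbT divr_ge0 // ltW.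
  by rewrite /sg; case: ifP => [/eqP ->|_]; [exact: ra|exact: rv].
- rewrite /spread (spr (fun z => (z - y) ^+ 1)) !expr1 subrr add0r.
  rewrite (@bernstein_mean_ext _ _ _ _ (fun k => vs k - y)); last by move=> k _; rewrite expr1.
  by move: mom; rewrite mulrN.
- move=> W q W0 [qy _].
  have -> : \sum_(k < n.+1) w k * q (sg k) = s / 2 * W.
    rewrite -qy -(sum_at (fun=> s / 2 * q y) an); apply: eq_bigr => k _.
    by rewrite /w /sg; case: ifP => _ //; rewrite mul0r.
  rewrite (_ : 2 * n%:R * _ = W * (n%:R * s)); last by field.
  rewrite ler_wpM2l // /spread (spr (fun z => (z - y) ^+ 2)) subrr expr0n /= sub0r.
  have [_ <- _ _] := bernstein_central_moments n x.
  have := bernstein_mean_le x01' vle.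
  suff : 0 <= s / 2 * (vs a - y) ^+ 2 by lra.
  by rewrite mulr_ge0 ?sqr_ge0 // divr_ge0 // ltW.
Qed.

End Atom.

(** Both this lemma and the next one expand about the corner
    ka = d = (2 - g) / 3 of the region d <= ka, 2 (1 - d) - g <= ka, at which
    the form equals (2 g - 1)^2 (5 g + 8) / 27; here the active edge is
    ka = d. *)
Lemma boundary_ineq_above (R : realFieldType) (g u t d ka : R) :
  d = (2 - g) / 3 + u -> ka = d + t -> 0 <= g <= 1 -> 0 <= u -> 0 <= t ->
  0 <= g * ka ^+ 2 + ka * (2 * g ^+ 2 - g + d ^+ 2) - g * (1 - g) * (g + 1 - d).
Proof.
move=> -> -> /andP[g0 g1] u0 t0.
have h1 : 0 <= (2 * g - 1) ^+ 2 * (5 * g + 8) by rewrite mulr_ge0 ?sqr_ge0 //; lra.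
have a1: 0 <= g * u by nra.
have -> : g * ((2 - g) / 3 + u + t) ^+ 2 + ((2 - g) / 3 + u + t) * (2 * g ^+ 2 - g + ((2 - g) / 3 + u) ^+ 2) - g * (1 - g) * (g + 1 - ((2 - g) / 3 + u)) =
 (2 * g - 1) ^+ 2 * (5 * g + 8) / 27 + u * ((2-g)^+2/3 + 2 * g * (2-g)/3 + g^+2) + u ^+ 2 * (2 - g + g) + u ^+ 3 + t * ((2-g)^+2/9 + 2 * g *(2-g)/3 + 2 * g ^+ 2 - g + u * (2 *(2-g)/3 + 2 * g) + u ^+ 2 ) + g * t ^+2.
  by field.
have p1 : 0 <= u * ((2-g)^+2/3 + 2 * g * (2-g)/3 + g^+2) by apply: mulr_ge0 => //; nra.
have p2 : 0 <= u ^+ 2 * (2 - g + g) by rewrite mulr_ge0 ?sqr_ge0 //; lra.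
have p3 : 0 <= u ^+ 3 by rewrite exprn_ge0.
have p4 : 0 <= t * ((2-g)^+2/9 + 2 * g *(2-g)/3 + 2 * g ^+ 2 - g + u * (2 *(2-g)/3 + 2 * g) + u ^+ 2 ).
  apply: mulr_ge0 => //.
  have : 0 <= u * (2 *(2-g)/3 + 2 * g) by apply: mulr_ge0 => //; lra.
  have : 0 <= u ^+2 by rewrite sqr_ge0.
  nra.
have p5 : 0 <= g * t ^+ 2 by rewrite mulr_ge0 ?sqr_ge0.
lra.
Qed.
(** The active edge is ka = 2 (1 - d) - g.  The form also vanishes at its end
    g = d = 0, so near that end squares centred at g = 7 d / 5 are used instead
    of the expansion about the corner. *)
Lemma boundary_ineq_below (R : realFieldType) (g v t d ka : R) :
  d = (2 - g) / 3 - v -> ka = (2 - g) / 3 + 2 * v + t -> 0 <= g <= 1 ->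
  0 <= v <= (2 - g) / 3 -> 0 <= t ->
  0 <= g * ka ^+ 2 + ka * (2 * g ^+ 2 - g + d ^+ 2) - g * (1 - g) * (g + 1 - d).
Proof.
move=> -> -> {d ka} /andP[g0 g1] /andP[v0 v1] t0.
have q1 : 0 <= (2 * g - 1) ^+ 2 * (5 * g + 8) by rewrite mulr_ge0 ?sqr_ge0 //; lra.
have -> : g * ((2 - g) / 3 + 2 * v + t) ^+ 2 + ((2 - g) / 3 + 2 * v + t) * (2 * g ^+ 2 - g + ((2 - g) / 3 - v) ^+ 2) - g * (1 - g) * (g + 1 - ((2 - g) / 3 - v))
 = t * (g * (2 * ((2-g)/3 + 2 * v)) + 2 * g ^+ 2 - g + ((2 - g) / 3 - v) ^+ 2) + g * t ^+ 2 +
  (g * ((2 - g) / 3 + 2 * v) ^+ 2 + ((2 - g) / 3 + 2 * v) * (2 * g ^+ 2 - g + ((2 - g) / 3 - v) ^+ 2) - g * (1 - g) * (g + 1 - ((2 - g) / 3 - v))) by field.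
have p5 : 0 <= g * t ^+ 2 by rewrite mulr_ge0 ?sqr_ge0.
have p4 : 0 <= t * (g * (2 * ((2-g)/3 + 2 * v)) + 2 * g ^+ 2 - g + ((2 - g) / 3 - v) ^+ 2).
  apply: mulr_ge0 => //.
  have : 0 <= g * v by apply: mulr_ge0.
  have : 0 <= g ^+ 2 by exact: sqr_ge0.
  have : 0 <= ((2 - g) / 3 - v) ^+ 2 by exact: sqr_ge0.
  nra.
have p6 : 0 <= (g * ((2 - g) / 3 + 2 * v) ^+ 2 + ((2 - g) / 3 + 2 * v) * (2 * g ^+ 2 - g + ((2 - g) / 3 - v) ^+ 2) - g * (1 - g) * (g + 1 - ((2 - g) / 3 - v))).
  rewrite (_ : _ - _ = (2 * g - 1) ^+ 2 * (5 * g + 8) / 27 + (11 * g ^+ 2 - g) / 3 * v + (5 * g - 2) * v ^+ 2 + 2 * v ^+ 3); last by field.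
  have v3 : 0 <= v ^+ 3 by rewrite exprn_ge0.
  (* For g >= 2 / 5 all coefficients in v are nonnegative. *)
  have [g2|g2] := leP (2 / 5) g.
    have : 0 <= (11 * g ^+ 2 - g) / 3 * v by apply: mulr_ge0 => //; nra.
    have : 0 <= (5 * g - 2) * v ^+ 2 by rewrite mulr_ge0 ?sqr_ge0 //; lra.
    lra.
  have [vs|vl] := leP v (1 / 5 - g / 3).
    have e1 : (2 - 5 * g) * v ^+ 2 <= (2 - 5 * g) * (1 / 5 - g / 3) ^+ 2.
      by rewrite ler_wpM2l ?ler_sqr ?nnegrE //; lra.
    have e2 : g * v <= g * (1 / 5) by rewrite ler_wpM2l //; lra.
    have e3 : 0 <= g ^+ 2 * v by rewrite mulr_ge0 ?sqr_ge0.
    have e4 : 0 <= g ^+ 2 * (2 / 5 - g) by rewrite mulr_ge0 ?sqr_ge0 //; lra.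
    nra.
  have -> : (2 * g - 1) ^+ 2 * (5 * g + 8) / 27 + (11 * g ^+ 2 - g) / 3 * v + (5 * g - 2) * v ^+ 2 + 2 * v ^+ 3 = (1 - ((2 - g) / 3 - v)) * (g - 7 / 5 * ((2 - g) / 3 - v)) ^+ 2 + (1 - ((2 - g) / 3 - v)) * (1 / 25) * ((2 - g) / 3 - v) ^+ 2 + g * (1 - 11 / 5 * ((2 - g) / 3 - v) + 1 / 5 * ((2 - g) / 3 - v)^+2) by field.
  have d0 : 0 <= (2 - g) / 3 - v by lra.
  have d1 : (2 - g) / 3 - v <= 7 / 15 by lra.
  move: ((2 - g) / 3 - v) d0 d1 => d d0 d1.
  have ? : 0 <= (1 - d) * (g - 7 / 5 * d) ^+ 2 by rewrite mulr_ge0 ?sqr_ge0 //; lra.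
  have ? : 0 <= (1 - d) * (1 / 25) * d ^+ 2 by rewrite mulr_ge0 ?sqr_ge0 //; lra.
  have ? : 0 <= g * (1 - 11 / 5 * d + 1 / 5 * d ^+ 2) by rewrite mulr_ge0 //; nra.
  lra.
lra.
Qed.
Lemma boundary_ineq (R : realFieldType) (g d ka : R) :
  0 <= g <= 1 -> 0 <= d <= ka -> 2 * (1 - d) <= ka + g ->
  0 <= g * ka ^+ 2 + ka * (2 * g ^+ 2 - g + d ^+ 2) - g * (1 - g) * (g + 1 - d).
Proof.
move=> g01 /andP[d0 dk] kg.
have [dl|dr] := leP ((2 - g) / 3) d.
  by apply: (@boundary_ineq_above _ g (d - (2 - g) / 3) (ka - d)) => //; lra.
apply: (@boundary_ineq_below _ g ((2 - g) / 3 - d) (ka - ((2 - g) / 3 + 2 * ((2 - g) / 3 - d)))) => //; lra.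
Qed.

Section Central.
Variable R : realType.
Implicit Types (x s : R) (n j k a : nat) (vs phi : nat -> R).

Local Notation node := (akr_node R).
Local Notation p n k x := (bernstein_basis n k x).
Local Notation Em := (@bernstein_mean R).

Lemma bernstein_mean_ge_term n x phi a : 0 <= x <= 1 -> (a <= n)%N ->
  (forall k, (k <= n)%N -> 0 <= phi k) -> phi a * p n a x <= Em n x phi.
Proof.
move=> x01 an phi0; rewrite /bernstein_mean (bigD1 (Ordinal (an : (a < n.+1)%N))) //=.
rewrite lerDl; apply: sumr_ge0 => k _.
by rewrite mulr_ge0 ?bernstein_basis_ge0 // phi0 // -ltnS.
Qed.

Lemma bernstein_basis_nn n x : p n n x = x ^+ n.
Proof. by rewrite /bernstein_basis binn subnn expr0 mulr1 mul1r. Qed.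

Lemma bernstein_mean_shift n x phi :
  Em n x (fun k => phi k - n%:R * x) = Em n x (fun k => phi k - k%:R).
Proof.
have [M1 _ _ _] := bernstein_central_moments n x.
rewrite -[RHS]addr0 -[X in _ = _ + X]M1 -bernstein_meanD.
by apply: bernstein_mean_ext => k _; ring.
Qed.

(** Both (n - k) x p_k and (k + 1) (1 - x) p_(k+1) are half the mean
    deviation, and both cofactors are at most 1 + (n - 1) s. *)
Lemma central_weights n k x : (2 <= n)%N -> 0 < x < 1 -> (k < n)%N ->
  k%:R <= n%:R * x <= k.+1%:R ->
  n%:R * (x * (1 - x)) ^+ 3 <= 23 / 100 ->
  x * (1 - x) / 2 <= p n k x /\ x * (1 - x) / 2 <= p n k.+1 x.
Proof.
move=> n2 x01 kn ky ns; have := mean_deviation_central n2 x01 ns.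
have x01' : 0 <= x <= 1 by case/andP: x01 => /ltW -> /ltW ->.
have p1 := bernstein_basis_ge0 n k x01'; have p2 := bernstein_basis_ge0 n k.+1 x01'.
have n2' : 2 <= n%:R :> R by rewrite ler_nat.
case/andP: x01 => x0 x1; case/andP: (ky) => k1; rewrite -natr1 => k2.
have s0 : 0 < x * (1 - x) by rewrite mulr_gt0 ?subr_gt0.
have b0 : 0 < 1 + (n%:R - 1) * (x * (1 - x)) by rewrite ltr_wpDr // mulr_ge0 ?(ltW s0) //; lra.
have c1 : (n%:R - k%:R) * x <= 1 + (n%:R - 1) * (x * (1 - x)).
  have : 0 <= x * (k%:R + 1 - n%:R * x) by rewrite mulr_ge0 //; lra.
  have : 0 <= (1 - x) ^+ 2 by exact: sqr_ge0.
  nra.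
have c2 : k.+1%:R * (1 - x) <= 1 + (n%:R - 1) * (x * (1 - x)).
  rewrite -natr1; have : 0 <= (1 - x) * (n%:R * x - k%:R) by rewrite mulr_ge0 //; lra.
  have : 0 <= x ^+ 2 by exact: sqr_ge0.
  nra.
move=> M; split; rewrite -(ler_pM2l b0).
  apply: le_trans (_ : (n%:R - k%:R) * x * p n k x <= _); last by rewrite ler_wpM2r.
  by move: M; rewrite (mean_deviationE (ltnW kn) ky); lra.
apply: le_trans (_ : k.+1%:R * (1 - x) * p n k.+1 x <= _); last by rewrite ler_wpM2r.
by move: M; rewrite (mean_deviation_succE (ltnW kn) ky); lra.
Qed.

Lemma reachable_mean_below n j k x : (1 < j <= n)%N -> (k < n)%N ->
  k%:R <= n%:R * x <= k.+1%:R -> reachable n j k.+1 (n%:R * x).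
Proof.
move=> jn kn /andP[ky yk]; apply: reachable_lower => //.
  by apply: le_trans ky.
by rewrite yk andbT -natr1 addrK.
Qed.

Lemma transportable_down_central n j k x : 0 < x < 1 -> (1 < j <= n)%N -> (k < n)%N ->
  k%:R <= n%:R * x <= k.+1%:R -> x * (1 - x) / 2 <= p n k.+1 x ->
  transportable n j x false.
Proof.
move=> x01 jn kn ky pk; apply: (@atom_transport _ _ _ _ _ k.+1 (fun i => i%:R)) => //.
- exact: reachable_mean_below.
- by move=> i; exact: reachable_id.
- have [-> _ _ _] := bernstein_central_moments n x.
  rewrite /= sub0r oppr_le0 mulr_ge0 //; last by case/andP: ky => _; rewrite subr_ge0.
  by case/andP: x01 => x0 x1; rewrite divr_ge0 // mulr_ge0 // ?subr_ge0 ltW.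
Qed.

Lemma transportable_up_at n j k x : 0 < x < 1 -> (1 < j <= n)%N -> (k <= n)%N ->
  k%:R <= n%:R * x -> n%:R * x <= n%:R * node n j k + (j%:R - 1) ->
  x * (1 - x) / 2 <= p n k x -> transportable n j x true.
Proof.
move=> x01 jn kn ky yT pk; apply: (@atom_transport _ _ _ _ _ k (fun i => i%:R)) => //.
- apply: reachable_range => //; last by apply: le_trans ky; lra.
  by rewrite (le_trans _ ky) //= ler_piMr //; case/andP: x01 => _ /ltW.
- by move=> i; exact: reachable_id.
- have [-> _ _ _] := bernstein_central_moments n x.
  rewrite /= sub0r -mulrN mulr_ge0 //; last by rewrite opprB subr_ge0.
  by case/andP: x01 => x0 x1; rewrite divr_ge0 // mulr_ge0 // ?subr_ge0 ltW.
Qed.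

(** If the mean is beyond the reach of node k, the atom is taken from node
    k + 1, which lowers the mean by at most (1 - rho) s / 2; pushing node k up by
    rho repairs this. *)
Lemma transportable_up_room n j k x (rho : R) : 0 < x < 1 -> (1 < j <= n)%N -> (k < n)%N ->
  k%:R <= n%:R * x <= k.+1%:R -> 0 <= rho ->
  k%:R + rho <= n%:R * node n j k + (j%:R - 1) ->
  x * (1 - x) / 2 <= p n k x -> x * (1 - x) / 2 <= p n k.+1 x ->
  x * (1 - x) / 2 * (1 - rho) <= rho * p n k x ->
  transportable n j x true.
Proof.
move=> x01 jn kn ky rho0 room pk pk1 prho.
have [yr|ry] := leP (n%:R * x) (k%:R + rho).
  apply: (@transportable_up_at _ _ k) => //; first exact: ltnW.
    by case/andP: ky.
  exact: le_trans yr room.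
have x01' : 0 <= x <= 1 by case/andP: x01 => /ltW -> /ltW ->.
have yn : n%:R * x <= n%:R by rewrite ler_piMr //; case/andP: x01'.
pose vs i := if i == k then k%:R + rho else i%:R.
apply: (@atom_transport _ _ _ _ _ k.+1 vs) => //.
- exact: reachable_mean_below.
- move=> i ni; rewrite /vs; case: ifP => [/eqP ->|_]; last exact: reachable_id.
  apply: reachable_range => //; first exact: ltnW.
    by rewrite addr_ge0 // (le_trans (ltW ry)).
  lra.
- move=> i _; rewrite /vs; case: ifP => [/eqP ->|_] //.
  rewrite -sqrrN -[leRHS]sqrrN ler_sqr ?nnegrE; lra.
- rewrite /= bernstein_mean_shift /vs gtn_eqF //.
  have := @bernstein_mean_ge_term n x (fun i => vs i - i%:R) k x01' (ltnW kn).
  rewrite /vs eqxx addrAC subrr add0r => H; have {}H := H _.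
  apply: le_trans (_ : rho * p n k x - x * (1 - x) / 2 * (1 - rho) <= _).
    by rewrite subr_ge0.
  apply: lerB.
    apply: H => i _; case: ifP => [/eqP ->|_]; last by rewrite subrr.
    by rewrite [_ - _]addrAC subrr add0r.
  apply: ler_wpM2l; last by rewrite -natr1; lra.
  by case/andP: x01' => x0 x1; rewrite divr_ge0 // mulr_ge0 ?subr_ge0.
Qed.

(** Node k = j - 1 sits at 0 and cannot move above k, so the atom comes from
    node k + 1.  The nodes below k are at 0 too, and raising all of them to k
    compensates the loss. *)
Lemma transportable_up_boundary n k x : 0 < x < 1 -> (0 < k < n)%N ->
  k%:R <= n%:R * x <= k.+1%:R -> x * (1 - x) / 2 <= p n k.+1 x ->
  (let gain := Em n x (fun i => if (i < k)%N then k%:R - i%:R else 0) in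
   x * (1 - x) / 2 * (k.+1%:R - n%:R * x) <= gain) ->
  transportable n k.+1 x true.
Proof.
move=> x01 /andP[k0 kn] ky pk gain; have jn : (1 < k.+1 <= n)%N by rewrite ltnS k0 kn.
pose vs i : R := if (i < k)%N then k%:R else i%:R.
apply: (@atom_transport _ _ _ _ _ k.+1 vs) => //.
- exact: reachable_mean_below.
- move=> i ni; rewrite /vs; case: ltnP => ik; last exact: reachable_id.
  apply: reachable_range => //; first by rewrite ler0n ler_nat ltnW.
    have : i%:R <= k%:R :> R by rewrite ler_nat ltnW.
    lra.
  by rewrite -natr1 addrK lerDr mulr_ge0 ?akr_node_ge0.
- move=> i _; rewrite /vs; case: ltnP => ik //.
  have : i%:R <= k%:R :> R by rewrite ler_nat ltnW.
  case/andP: ky => ky _.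
  by move=> ik'; rewrite -sqrrN -[leRHS]sqrrN ler_sqr ?nnegrE; lra.
- rewrite /= bernstein_mean_shift /vs ltnNge leqnSn /= subr_ge0.
  rewrite (@bernstein_mean_ext _ _ _ _ (fun i => if (i < k)%N then k%:R - i%:R else 0)) //.
  by move=> i _; case: ifP => // _; rewrite subrr.
Qed.

(** The gain from node k - 1 alone suffices.  In terms of ka = k (1 - x) and
    g = y - k, ratios of consecutive weights turn this into [boundary_ineq]. *)
Lemma transportable_up_boundary_inner n k x : 0 < x < 1 -> (0 < k)%N -> (k.+1 < n)%N ->
  k%:R <= n%:R * x <= k.+1%:R ->
  n%:R * (x * (1 - x)) ^+ 3 <= 23 / 100 ->
  transportable n k.+1 x true.
Proof.
move=> x01 k0 kn ky ns; have kn' := ltnW kn.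
have n2 : (2 <= n)%N by apply: leq_trans kn.
have [_ pk1] := central_weights n2 x01 kn' ky ns.
apply: transportable_up_boundary => //=; first by rewrite k0.
have x01' : 0 <= x <= 1 by case/andP: x01 => /ltW -> /ltW ->.
have M := mean_deviation_central n2 x01 ns.
rewrite (mean_deviationE (ltnW kn') ky) in M.
case: k k0 kn ky kn' pk1 M => // k _ kn ky kn' pk1 M.
have := @bernstein_mean_ge_term n x (fun i => if (i < k.+1)%N then k.+1%:R - i%:R else 0) k x01' (ltnW (ltnW kn')).
rewrite ltnSn -natr1 addrAC subrr add0r mul1r => H.
apply: le_trans (H _); last first.
  by move=> i _; case: ltnP => // ik; rewrite natr1 subr_ge0 ler_nat ltnW.
have q0 := bernstein_basis_ge0 n k x01'.
have ratio := bernstein_basis_ratio x (ltnW (ltnW kn')).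
move: (p n k x) (p n k.+1 x) ratio M q0 => q q1 ratio M q0.
set N : R := n%:R in ky M ratio *; set K : R := k.+1%:R in ky M ratio *.
case/andP: ky => ky1; rewrite -natr1 -/K => ky2.
have N2 : K + 2 <= N by rewrite /K -natrD addn2 ler_nat.
have K1 : 1 <= K by rewrite /K ler1n.
have kE : k%:R = K - 1 by rewrite /K -natr1 addrK.
rewrite kE in ratio *.
case/andP: x01 => x0 x1.
pose g := N * x - K; pose ka := K * (1 - x).
have Q : q * ((ka + g + x) * (ka + g)) = ka * (ka + g) * q1.
  rewrite (_ : ka * (ka + g) * q1 = (ka + g) * (ka * q1)); last by ring.
  by rewrite /ka ratio /ka /g; ring.
have ineq := @boundary_ineq _ g (1 - x) ka.
have g01 : 0 <= g <= 1 by rewrite /g; apply/andP; split; lra.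
have d0 : 0 <= 1 - x <= ka.
  by apply/andP; split; [lra|rewrite /ka ler_peMl //; lra].
have d2 : 2 * (1 - (1 - x)) <= ka + g.
  rewrite (_ : ka + g = (N - K) * x); last by rewrite /ka /g; ring.
  by rewrite subKr ler_wpM2r //; lra.
have {}ineq := ineq g01 d0 d2.
have s0 : 0 < x * (1 - x) by rewrite mulr_gt0 ?subr_gt0.
have Z0 : 0 < (ka + g + x) * (ka + g).
  have : 0 < ka + g by lra.
  by move=> ?; rewrite mulr_gt0 //; lra.
rewrite -(ler_pM2r Z0) Q.
have b : (1 - g) * (ka + g + x) * (ka + g) <= ka * (1 + (N - 1) * (x * (1 - x))).
  rewrite -subr_ge0; move: ineq; rewrite /ka /g => /le_trans; apply.
  by rewrite le_eqVlt; apply/orP; left; apply/eqP; ring.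
have ka0 : 0 <= ka by case/andP: d0; apply: le_trans.
have : ka * (x * (1 - x) * (1 + (N - 1) * (x * (1 - x)))) <= ka * (2 * ((N - K) * x * q1)).
  exact: ler_wpM2l.
have : x * (1 - x) * ((1 - g) * (ka + g + x) * (ka + g)) <= x * (1 - x) * (ka * (1 + (N - 1) * (x * (1 - x)))).
  by rewrite ler_wpM2l // ltW.
have -> : K + 1 - N * x = 1 - g by rewrite /g; ring.
have -> : (N - K) * x = ka + g by rewrite /ka /g; ring.
lra.
Qed.
End Central.

Section CentralUp.
Variable R : realType.
Implicit Types (x s : R) (n j k a : nat) (vs phi : nat -> R).

Local Notation node := (akr_node R).
Local Notation p n k x := (bernstein_basis n k x).
Local Notation Em := (@bernstein_mean R).

Lemma bernoulli_second_order n (d : R) : (0 < n)%N -> 0 <= d <= 1 ->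
  1 - n%:R * d + (n%:R - 1) * d ^+ 2 <= (1 - d) ^+ n.
Proof.
move=> n0 /andP[d0 d1]; case: n n0 => // n _.
elim: n => [|n IH]; first by rewrite expr1; lra.
rewrite exprS; apply: le_trans (ler_wpM2l _ IH); last by rewrite subr_ge0.
rewrite -[n.+2]addn2 -[n.+1]addn1 !natrD -subr_ge0.
rewrite [X in 0 <= X](_ : _ = n%:R * d ^+ 2 * (1 - d)); last by ring.
by rewrite !mulr_ge0 ?sqr_ge0 // subr_ge0.
Qed.

(** For j = n the gain is explicit, y - (n - 1) being corrected by x^n, and
    the Bernoulli inequality of second order bounds x^n. *)
Lemma transportable_up_boundary_last n x : 0 < x < 1 -> (1 < n)%N ->
  n.-1%:R <= n%:R * x -> x * (1 - x) / 2 <= p n n x -> transportable n n x true.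
Proof.
case: n => // k x01 k0 ky pk.
have x01' : 0 <= x <= 1 by case/andP: x01 => /ltW -> /ltW ->.
have yn : k.+1%:R * x <= k.+1%:R by rewrite ler_piMr //; case/andP: x01'.
apply: transportable_up_boundary => //=.
- by rewrite -ltnS k0 /=.
- by rewrite ky yn.
have -> : Em k.+1 x (fun i => if (i < k)%N then k%:R - i%:R else 0)
    = Em k.+1 x (fun i => (if i == k.+1 then 1 else 0) + (k%:R - k.+1%:R * x + - 1 * (i%:R - k.+1%:R * x))).
  apply: bernstein_mean_ext => i ik; case: ltnP => ki.
    by rewrite ltn_eqF ?ltnS 1?ltnW //; ring.
  have [->|ik'] := eqVneq i k.+1; first by rewrite -natr1; ring.
  have -> : i = k by apply/eqP; rewrite eqn_leq ki andbT -ltnS ltn_neqAle ik'.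
  by ring.
have [M1 _ _ _] := bernstein_central_moments k.+1 x.
rewrite bernstein_meanD bernstein_meanD bernstein_meanZ M1 bernstein_mean_cst mulr0 addr0.
have -> : Em k.+1 x (fun i => if i == k.+1 then 1 else 0) = (1 - (1 - x)) ^+ k.+1.
  rewrite subKr -bernstein_basis_nn -(sum_at (fun i => p k.+1 i x) (leqnn k.+1)).
  by apply: eq_bigr => i _; case: ifP => _; rewrite ?mul1r ?mul0r.
have d01 : 0 <= 1 - x <= 1 by case/andP: x01' => *; apply/andP; split; lra.
have B := bernoulli_second_order (ltn0Sn k) d01.
have k1 : 1 <= k%:R :> R by rewrite ler1n -ltnS.
have P : 0 <= (1 - x) ^+ 2 * (k%:R - x * (k%:R + 1) / 2).
  rewrite mulr_ge0 ?sqr_ge0 //; case/andP: x01' => x0 x1.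
  have : x * (k%:R + 1) <= 1 * (k%:R + 1) by rewrite ler_wpM2r //; lra.
  lra.
have kE : k.+1%:R = k%:R + 1 :> R by rewrite natr1.
move: B; set E := (1 - (1 - x)) ^+ k.+1; rewrite kE => B.
lra.
Qed.

(** This makes c = n / (3 (V + x) / 2) admissible in [mean_deviation_ge]. *)
Lemma low_degree_ineq n k x : 0 < x < 1 -> (2 <= k < n)%N ->
  (4 * (k * k.-1) < n.-1)%N -> k%:R <= n%:R * x <= k.+1%:R ->
  (1 + 3 * (n%:R - 2) * (x * (1 - x))) * (3 / 2 * (n%:R * (x * (1 - x)) + x)) ^+ 2
    <= n%:R ^+ 2.
Proof.
move=> /andP[x0 x1] /andP[k2 kn] big /andP[ky]; rewrite -natr1 => yk.
have s0 : 0 < x * (1 - x) by rewrite mulr_gt0 ?subr_gt0.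
have Nk : 4 * (k%:R * (k%:R - 1)) + 2 <= n%:R :> R.
  have -> : k%:R - 1 = k.-1%:R :> R by rewrite -[in LHS](prednK (ltnW k2)) -natr1 addrK.
  by rewrite -!natrM -natrD ler_nat; lia.
have K2 : 2 <= k%:R :> R by rewrite ler_nat.
have k3E : k%:R = 2 :> R \/ 3 <= k%:R :> R.
  by have [k3|k3] := leqP 3 k; [right; rewrite ler_nat|left; congr (_%:R); lia].
move: (n%:R : R) (k%:R : R) ky yk Nk K2 k3E => N K ky yk Nk K2 k3E.
have N10 : 10 <= N by have : 0 <= (K - 2) * (K + 1) by [rewrite mulr_ge0 //; lra]; lra.
have V0 : 0 <= N * (x * (1 - x)) by rewrite mulr_ge0 ?ltW //; lra.
have Ax : N * (x * (1 - x)) + x <= K + 1.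
  by have : 0 <= x * (N * x - 1) by [rewrite mulr_ge0 ?ltW //; lra]; lra.
have Q1 : 1 + 3 * (N - 2) * (x * (1 - x)) <= 3 * K + 4.
  by have : 0 <= N * x * x by [rewrite !mulr_ge0 ?ltW //; lra]; lra.
have Q0 : 0 <= 1 + 3 * (N - 2) * (x * (1 - x)).
  by have : 0 <= (N - 2) * (x * (1 - x)) by [rewrite mulr_ge0 ?(ltW s0) //; lra]; lra.
case: k3E => [KE|K3].
  rewrite {}KE in ky yk Nk K2 Ax Q1.
  have NA : N * (N * (x * (1 - x)) + x) <= 3 * N - 6.
    by have : 0 <= (3 - N * x) * (N - 2 - N * x) by [rewrite mulr_ge0 //; lra]; lra.
  have NQ : N * (1 + 3 * (N - 2) * (x * (1 - x))) <= 10 * N - 27.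
    have : 0 <= (3 - N * x) * (N - 3 - N * x) by rewrite mulr_ge0 //; lra.
    by have : 0 <= N * (x * (1 - x)) by []; lra.
  have N0 : 0 < N by lra.
  rewrite -(ler_pM2l (exprn_gt0 3 N0)).
  apply: (@le_trans _ _ ((10 * N - 27) * (3 / 2 * (3 * N - 6)) ^+ 2)).
    rewrite (_ : N ^+ 3 * _ = (N * (1 + 3 * (N - 2) * (x * (1 - x))))
       * (3 / 2 * (N * (N * (x * (1 - x)) + x))) ^+ 2); last by ring.
    apply: ler_pM => //; rewrite ?sqr_ge0 //; first by rewrite mulr_ge0 ?(ltW N0).
    have : 0 <= N * (N * (x * (1 - x)) + x) by rewrite mulr_ge0 ?(ltW N0) // addr_ge0 // ltW.
    by move=> ?; rewrite ler_sqr ?nnegrE; lra.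
  have m0 : 0 <= N - 10 by lra.
  (* Expanding at N = 10 leaves nonnegative coefficients only; likewise at
     K = 3 below. *)
  rewrite -subr_ge0 [X in 0 <= X](_ : _ = 5392 + 13388 * (N - 10)
    + (21127 / 4) * (N - 10) ^+ 2 + (1595 / 2) * (N - 10) ^+ 3
    + 50 * (N - 10) ^+ 4 + (N - 10) ^+ 5); last by field.
  have := exprn_ge0 2 m0; have := exprn_ge0 3 m0; have := exprn_ge0 4 m0.
  have := exprn_ge0 5 m0; lra.
apply: (@le_trans _ _ ((3 * K + 4) * (3 / 2 * (K + 1)) ^+ 2)).
  apply: ler_pM => //; first by rewrite sqr_ge0.
  by rewrite ler_sqr ?nnegrE; lra.
apply: (@le_trans _ _ ((4 * (K * (K - 1)) + 2) ^+ 2)); last first.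
  rewrite ler_sqr ?nnegrE //; last by lra.
  by have : 0 <= (K - 2) * (K + 1) by [rewrite mulr_ge0 //; lra]; lra.
have m0 : 0 <= K - 3 by lra.
rewrite -subr_ge0 [X in 0 <= X](_ : _ = 208 + 698 * (K - 3) + (2099 / 4) * (K - 3) ^+ 2 + (613 / 4) * (K - 3) ^+ 3 + 16 * (K - 3) ^+ 4); last first.
  by field.
have := exprn_ge0 2 m0; have := exprn_ge0 3 m0; have := exprn_ge0 4 m0; lra.
Qed.

(** For j = 2 and n large compared with k^2 the room is only 2 / 5; the loss is
    made up by a weight of 3 s / 4 instead of s / 2. *)
Lemma bernstein_basis_low_degree n k x : 0 < x < 1 -> (2 <= k < n)%N ->
  (4 * (k * k.-1) < n.-1)%N -> k%:R <= n%:R * x <= k.+1%:R ->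
  3 / 4 * (x * (1 - x)) <= p n k x.
Proof.
move=> x01 /andP[k2 kn] big ky.
have x01' : 0 <= x <= 1 by case/andP: x01 => /ltW -> /ltW ->.
have [x0 x1] := andP x01; have [ky1 ky2] := andP ky.
set N : R := n%:R in ky ky1 ky2 *.
have K2 : 2 <= k%:R :> R by rewrite ler_nat.
have N0 : 0 < N by rewrite ltr0n (leq_trans _ kn).
set A := N * (x * (1 - x)) + x.
have s0 : 0 < x * (1 - x) by rewrite mulr_gt0 ?subr_gt0.
have A0 : 0 < A by rewrite /A; have := mulr_gt0 N0 s0; lra.
have ineq : (1 + 3 * (N - 2) * (x * (1 - x))) * (3 / 2 * A) ^+ 2 <= N ^+ 2.
  by apply: (@low_degree_ineq n k) => //; rewrite k2.
have c0 : 0 < N / (3 / 2 * A) by rewrite divr_gt0 // mulr_gt0.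
have := @mean_deviation_ge _ n x (N / (3 / 2 * A)) x01' c0.
rewrite expr_div_n ler_pdivlMr ?exprn_gt0 ?mulr_gt0 // => /(_ ineq).
rewrite (mean_deviationE (ltnW kn) ky) -/N.
rewrite [X in X <= _ -> _](_ : _ = 3 / 2 * (x * (1 - x)) * A); last first.
  by field; rewrite !gt_eqF //; lra.
have q0 := bernstein_basis_ge0 n k x01'.
have NA : (N - k%:R) * x <= A.
  have : 0 <= x * (k%:R + 1 - N * x) by rewrite mulr_ge0 //; move: ky2; rewrite -natr1; lra.
  rewrite /A; lra.
have := ler_wpM2r q0 NA => H1 H2.
rewrite -(ler_pM2l A0); lra.
Qed.

(** The position of k = floor y with respect to j decides how node k can move:
    freely up to k + 1 for k < j - 1, not beyond k for k = j - 1, and by the room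
    of the node for k >= j. *)
Lemma transportable_up_central n j k x : 0 < x < 1 -> (1 < j <= n)%N -> (k < n)%N ->
  k%:R <= n%:R * x <= k.+1%:R -> n%:R * (x * (1 - x)) ^+ 3 <= 23 / 100 ->
  transportable n j x true.
Proof.
move=> x01 jn kn ky ns.
have [j1 jn'] := andP jn; have n2 : (1 < n)%N by apply: leq_trans jn'.
have [pk pk1] := central_weights n2 x01 kn ky ns.
have s0 : 0 < x * (1 - x) by case/andP: x01 => x0 x1; rewrite mulr_gt0 ?subr_gt0.
have room rho : k%:R + rho <= n%:R * node n j k + (j%:R - 1) -> 2 / 5 <= rho ->
   (1 / 2 <= rho) || (3 / 4 * (x * (1 - x)) <= p n k x) -> transportable n j x true.
  (* A room above 1 / 2 is cut down to 1 / 2, where weights of s / 2 are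
     just enough. *)
  move=> hr r1 r2; wlog r4 : rho hr r1 r2 / rho <= 1 / 2.
    move=> W; have [|rl] := leP rho (1 / 2); first exact: W.
    by apply: (W (1 / 2)); rewrite ?lexx //; lra.
  apply: (@transportable_up_room _ n j k x rho) => //; first by lra.
  case/orP: r2 => r3.
    have -> : rho = 1 / 2 by apply/eqP; rewrite eq_le r4 r3.
    lra.
  have := ler_wpM2l (_ : 0 <= rho) r3 => /(_ ltac:(lra)).
  have : 0 <= (rho - 2 / 5) * (x * (1 - x)) by rewrite mulr_ge0 ?(ltW s0) //; lra.
  lra.
have [kj|jk] := ltnP k j; last first.
  have [j3|j2] := leqP 3 j.
    apply: (room (3 / 5)); [|lra|by apply/orP; left; lra].
    by apply: scaled_node_room3; rewrite ?j3.
  have {}j2 : j = 2%N by lia.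
  rewrite {}j2 in jk jn j1 jn' room *.
  have [big|small] := ltnP (4 * (k * k.-1)) n.-1.
    apply: (room (2 / 5)) => //; first exact: scaled_node_room2.
    by rewrite (bernstein_basis_low_degree x01 _ big ky) ?orbT // jk.
  apply: (room (1 / 2)); [|lra|by rewrite lexx].
  by apply: scaled_node_room2_half => //; apply: leq_trans jk.
have [kj'|jk] := ltnP k.+1 j.
  apply: (@transportable_up_at _ n j k) => //; [exact: ltnW|by case/andP: ky|].
  rewrite scaled_node_small ?kj // add0r.
  case/andP: ky => _ /le_trans; apply; rewrite -natr1.
  by rewrite lerBrDr !natr1 ler_nat.
have {kj jk} jE : j = k.+1 by lia.
rewrite {}jE in jn j1 jn' room *.
have [kn'|nk] := ltnP k.+1 n; first by apply: transportable_up_boundary_inner.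
have nE : n = k.+1 by lia.
rewrite nE in ky pk1 *; apply: transportable_up_boundary_last => //.
by case/andP: ky.
Qed.

Lemma transportable_central n j x up : 0 < x < 1 -> (1 < j <= n)%N ->
  n%:R * (x * (1 - x)) ^+ 3 <= 23 / 100 -> transportable n j x up.
Proof.
move=> x01 jn ns; have [x0 x1] := andP x01.
have [j1 jn'] := andP jn; have n2 : (1 < n)%N by apply: leq_trans jn'.
have n0 : 0 < n%:R :> R by rewrite ltr0n ltnW.
have /truncn_itv : 0 <= n%:R * x by rewrite mulr_ge0 ?ltW.
move: (Num.truncn _) => k /andP[ky yk].
have kn : (k < n)%N by rewrite -(ltr_nat R); apply: le_lt_trans ky _; rewrite gtr_pMr.
have {ky yk} ky : k%:R <= n%:R * x <= k.+1%:R by rewrite ky ltW.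
case: up; first exact: transportable_up_central ky ns.
have [_ pk1] := central_weights n2 x01 kn ky ns.
exact: transportable_down_central ky pk1.
Qed.

End CentralUp.

(** * Large n s^3: comparing the weights with their mirror image *)

Section MirrorImbalance.
Variable R : realType.
Implicit Types (x : R) (n k c : nat).

Local Notation p n k x := (bernstein_basis n k x).

(** (u - v) / (u + v) is the hyperbolic tangent of half the logarithm of u / v,
    so under products of ratios these quantities add by the addition formula
    (P + Q) / (1 + P Q), which is below P + Q. *)
Lemma imbalance_mul (u v a b P Q : R) : 0 <= u -> 0 <= v -> 0 <= a -> 0 <= b ->
  0 <= P -> 0 <= Q -> u - v <= P * (u + v) -> a - b <= Q * (a + b) ->
  u * a - v * b <= (P + Q) * (u * a + v * b).
Proof.
move=> u0 v0 a0 b0 P0 Q0 uv ab.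
have ua : 0 <= u * a by rewrite mulr_ge0.
have vb : 0 <= v * b by rewrite mulr_ge0.
have [PQ|PQ] := leP 1 (P + Q).
  have : 0 <= (P + Q - 1) * (u * a + v * b) by rewrite mulr_ge0 ?subr_ge0 ?addr_ge0.
  lra.
have key : (1 - P) * (1 - Q) * (u * a) <= (1 + P) * (1 + Q) * (v * b).
  have -> : (1 - P) * (1 - Q) * (u * a) = ((1 - P) * u) * ((1 - Q) * a) by ring.
  have -> : (1 + P) * (1 + Q) * (v * b) = ((1 + P) * v) * ((1 + Q) * b) by ring.
  by apply: ler_pM; rewrite ?mulr_ge0 //; lra.
have h : 0 < (1 + P) * (1 + Q) by rewrite mulr_gt0 //; lra.
rewrite -subr_ge0 -(pmulr_rge0 _ h).
have -> : (1 + P) * (1 + Q) * ((P + Q) * (u * a + v * b) - (u * a - v * b))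
  = (1 + P + Q) * ((1 + P) * (1 + Q) * (v * b) - (1 - P) * (1 - Q) * (u * a))
    + 2 * (P * Q) * (P + Q) * (u * a) by ring.
by rewrite addr_ge0 // !mulr_ge0 ?subr_ge0 // ?addr_ge0.
Qed.

Lemma signed_imbalance_mul (e : bool) (u v a b P Q : R) :
  0 <= u -> 0 <= v -> 0 <= a -> 0 <= b -> 0 <= P -> 0 <= Q ->
  (-1) ^+ e * (u - v) <= P * (u + v) -> (-1) ^+ e * (a - b) <= Q * (a + b) ->
  (-1) ^+ e * (u * a - v * b) <= (P + Q) * (u * a + v * b).
Proof.
case: e => u0 v0 a0 b0 P0 Q0; rewrite ?expr1 ?expr0 ?mulN1r ?mul1r ?opprB.
  rewrite [u + v]addrC [a + b]addrC [u * a + _]addrC.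
  exact: imbalance_mul.
exact: imbalance_mul.
Qed.

(** From the pair (k + 1, c - k - 1) to the pair (k, c - k) the two weights are
    multiplied by E and F up to a common factor.  The relative imbalance of the
    pair at distance i from C is therefore bounded by the sum of those of E and
    F over the steps, and the sum of theta^2 over half-odd theta < i is at most
    i^3 / 3.  For odd c the chain starts at i = 1 / 2 with half a step. *)
Lemma mirror_imbalance (e : bool) n c x (al be den : R) : 0 < x < 1 ->
  let C := c%:R / 2 in let V := n%:R * (x * (1 - x)) in
  0 <= al -> 0 <= be -> 0 < den ->
  2 * den <= ((C + 1 / 2) * (1 - x) + (n%:R - C + 1 / 2) * x) ^+ 2 ->
  (forall k : nat, (k.*2.+1 <= c)%N -> (c - k <= n)%N -> (C - k%:R) ^+ 2 <= 4 * V ->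
     let E := k.+1%:R * (c%:R - k%:R) * (1 - x) ^+ 2 in
     let F := (n%:R - c%:R + k.+1%:R) * (n%:R - k%:R) * x ^+ 2 in
     den <= E + F /\ (-1) ^+ e * (E - F) <= al + be * (C - k%:R - 1 / 2) ^+ 2) ->
  forall k : nat, (k.*2 <= c)%N -> (c - k <= n)%N -> (C - k%:R) ^+ 2 <= 4 * V ->
   (-1) ^+ e * (p n k x - p n (c - k) x)
     <= ((C - k%:R) * al + be * (C - k%:R) ^+ 3 / 3) / den * (p n k x + p n (c - k) x).
Proof.
move=> x01 C V al0 be0 den0 den2 step k; have [m mE] := ubnP (c - k.*2)%N.
elim: m k mE => // m IH k km kc ckn kV.
have x01' : 0 <= x <= 1 by case/andP: x01 => /ltW -> /ltW ->.
have [x0 x1] := andP x01.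
have p0 i := bernstein_basis_ge0 n i x01'.
have Ck : 0 <= C - k%:R.
  by rewrite subr_ge0 /C ler_pdivlMr // -natrM ler_nat muln2.
have rhs0 z : 0 <= z -> 0 <= (z * al + be * z ^+ 3 / 3) / den.
  by move=> z0; rewrite divr_ge0 ?(ltW den0) // addr_ge0 ?mulr_ge0 ?exprn_ge0.
have [kE|kc'] := eqVneq k.*2 c.
  have -> : (c - k)%N = k by rewrite -kE -addnn addnK.
  by rewrite subrr mulr0 mulr_ge0 ?addr_ge0 ?p0 //; exact: rhs0.
have {kc kc'} kc : (k.*2.+1 <= c)%N by rewrite ltn_neqAle kc' kc.
have [kn ck] : (k < n)%N /\ (k < c)%N by clear -kc ckn; lia.
have [EF EF'] := step k kc ckn kV.
set E := _ * _ * (1 - x) ^+ 2 in EF EF'; set F := _ * _ * x ^+ 2 in EF EF'.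
have ckE : (c - k)%:R = c%:R - k%:R :> R by rewrite natrB // ltnW.
have H0 : 0 < (n%:R - k%:R) * (c%:R - k%:R) * (x * (1 - x)).
  by rewrite !mulr_gt0 ?subr_gt0 // ltr_nat.
have [cE|kc'] := eqVneq c k.*2.+1.
  (* The two innermost weights are as A to B, and (A - B) (A + B) is the
     value of E - F at theta = 0. *)
  have -> : (c - k)%N = k.+1 by clear -cE; lia.
  have CE : C = k%:R + 1 / 2.
    by rewrite /C cE -natr1 -muln2 natrM; field.
  have cE' : c%:R = 2 * k%:R + 1 :> R by rewrite cE -natr1 -muln2 natrM; ring.
  have r := bernstein_basis_ratio x (ltnW kn).
  move: EF EF'; rewrite /E /F cE' -natr1 => EF EF'.
  rewrite -natr1 in r.
  rewrite CE [k%:R + 1 / 2 - k%:R](_ : _ = 1 / 2); last by ring.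
  rewrite CE in den2.
  set A := (k%:R + 1) * (1 - x) in r.
  set B := (n%:R - k%:R) * x in r.
  have A0 : 0 < A by rewrite mulr_gt0 ?subr_gt0 // ltr_wpDl.
  have B0 : 0 < B by rewrite mulr_gt0 ?subr_gt0 // ltr_nat.
  have {}den2 : 2 * den <= (A + B) ^+ 2.
    by apply: le_trans den2 _; rewrite le_eqVlt; apply/orP; left; apply/eqP; rewrite /A /B; field.
  have {EF'}EF' : (-1) ^+ e * ((A - B) * (A + B)) <= al.
    move: EF'; rewrite CE (_ : _ + 1 / 2 - _ - 1 / 2 = 0); last by ring.
    rewrite expr0n mulr0 addr0; apply: le_trans.
    by rewrite le_eqVlt; apply/orP; left; apply/eqP; rewrite /A /B; ring.
  have h0 : 0 <= p n k.+1 x / B by rewrite divr_ge0 ?p0 // ltW.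
  have -> : p n k x = p n k.+1 x / B * A.
    by rewrite mulrAC [_ * A]mulrC r mulrAC mulfV ?mul1r // gt_eqF.
  have -> : p n k.+1 x = p n k.+1 x / B * B by rewrite divfK // gt_eqF.
  rewrite mulfK ?gt_eqF // -mulrBr -mulrDr mulrCA [leRHS]mulrCA ler_wpM2l //.
  rewrite -(ler_pM2r (_ : 0 < A + B)); last by rewrite addr_gt0.
  rewrite -[leLHS]mulrA -[leRHS]mulrA -expr2; apply: le_trans EF' _.
  apply: (@le_trans _ _ ((1 / 2 * al + be * (1 / 2) ^+ 3 / 3) / den * (2 * den))); last first.
    by rewrite ler_wpM2l ?rhs0.
  rewrite [leRHS](_ : _ = al + be / 12); last by field; rewrite gt_eqF.
  by rewrite lerDl divr_ge0.
have r1 := bernstein_basis_ratio x (ltnW kn).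
have kc2 : (k.+1.*2 <= c)%N by clear -kc kc'; lia.
have cE : (c - k)%N = (c - k.+1).+1 by rewrite subnSK.
have r2 := @bernstein_basis_ratio R n (c - k.+1) x (_ : (_ <= n)%N).
rewrite -cE ckE in r2; have {}r2 : _ = _ := r2 ltac:(by clear -ckn kc; lia).
have ckE' : (c - k.+1)%:R = c%:R - k.+1%:R :> R by rewrite natrB.
rewrite ckE' in r2.
set h := _ * (x * (1 - x)) in H0.
have e1 : h * p n k x = p n k.+1 x * E.
  rewrite /h /E; move: r1; set q := p n k.+1 x; set q' := p n k x => r1.
  rewrite (_ : _ * q' = (c%:R - k%:R) * (1 - x) * ((n%:R - k%:R) * x * q')); last by ring.
  by rewrite -r1; ring.
have e2 : h * p n (c - k) x = p n (c - k.+1) x * F.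
  rewrite /h /F; move: r2; set q := p n (c - k) x; set q' := p n (c - k.+1) x => r2.
  rewrite (_ : _ * q = (n%:R - k%:R) * x * ((c%:R - k%:R) * (1 - x) * q)); last by ring.
  by rewrite r2; ring.
have E0 : 0 <= E by rewrite mulr_ge0 ?sqr_ge0 // mulr_ge0 // subr_ge0 ler_nat ltnW.
have F0 : 0 <= F.
  rewrite mulr_ge0 ?sqr_ge0 // mulr_ge0 ?subr_ge0 ?ler_nat 1?ltnW //.
  have -> : n%:R - c%:R + k.+1%:R = n%:R - (c - k.+1)%:R :> R by rewrite ckE'; ring.
  by rewrite subr_ge0 ler_nat; clear -ckn; lia.
have C1 : 1 <= C - k%:R.
  by rewrite lerBrDr nat1r /C ler_pdivlMr // -natrM ler_nat muln2.
have kE : C - k.+1%:R = C - k%:R - 1 by rewrite -natr1; ring.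
have := IH k.+1 ltac:(by clear -km kc2; lia) kc2 ltac:(by clear -ckn; lia).
rewrite kE => IHk.
have IHk' : (C - k%:R - 1) ^+ 2 <= 4 * V.
  by apply: le_trans kV; rewrite ler_sqr ?nnegrE; lra.
have {IHk'}IHk := IHk IHk'.
have Q0 : 0 <= (al + be * (C - k%:R - 1 / 2) ^+ 2) / den.
  by rewrite divr_ge0 ?(ltW den0) // addr_ge0 // mulr_ge0 ?sqr_ge0.
have EFQ : (-1) ^+ e * (E - F) <= (al + be * (C - k%:R - 1 / 2) ^+ 2) / den * (E + F).
  apply: le_trans EF' _; rewrite mulrAC ler_pdivlMr // ler_wpM2l //.
  by rewrite addr_ge0 // mulr_ge0 ?sqr_ge0.
have z0 : 0 <= C - k%:R - 1 by lra.
have := signed_imbalance_mul (p0 _) (p0 _) E0 F0 (rhs0 _ z0) Q0 IHk EFQ.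
rewrite -e1 -e2 -mulrBr -mulrDr mulrCA [leRHS]mulrCA ler_pM2l //.
move=> /le_trans; apply.
rewrite ler_wpM2r ?addr_ge0 ?p0 // -mulrDl ler_pM2r ?invr_gt0 //.
rewrite -subr_ge0 [X in 0 <= X](_ : _ = be / 12); last by field.
by rewrite divr_ge0.
Qed.

End MirrorImbalance.

Section MirrorCloseness.
Variable R : realType.
Implicit Types (x : R) (n k c : nat).

Local Notation p n k x := (bernstein_basis n k x).

(** The first term bounds the drift of the ratio at the centre, due to the
    offset del of C from the mean and to the skewness D, the second one the
    effect of the skewness away from the centre.  Positive parts are taken
    because a term of the favourable sign may be dropped. *)
Lemma skew_bound (e : bool) (V D del : R) : 0 <= V -> -1 < D < 1 -> 0 <= del <= 1 / 2 ->
  Num.max 0 ((-1) ^+ e * (del + D / 2)) * (2 * V + 1 / 2 + del * D)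
    + 4 * V * (Num.max 0 (- (-1) ^+ e * D)) / 3
  <= (1 + `|D|) * (V + (1 + `|D|) / 4).
Proof.
move=> V0 /andP[D1 D2] /andP[del0 del2].
have [D0|D0] := leP 0 D.
  rewrite (ger0_norm D0).
  have dD : 0 <= del * D by rewrite mulr_ge0.
  have VD : 0 <= V * D by rewrite mulr_ge0.
  case: e; rewrite ?expr1 ?expr0 ?opprK ?mulN1r ?mul1r.
    rewrite (max_l (_ : - (del + D / 2) <= 0)); last by lra.
    rewrite (max_r D0); nra.
  rewrite (max_r (_ : 0 <= del + D / 2)); last by lra.
  rewrite (max_l (_ : - D <= 0)); last by lra.
  have h1 : 0 <= (1 / 2 - del) * V by rewrite mulr_ge0 //; lra.
  have h2 : 0 <= (1 / 2 - del) * D by rewrite mulr_ge0 //; lra.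
  have h3 : 0 <= (1 / 2 - del) * D * del by rewrite mulr_ge0 //; lra.
  have h4 : 0 <= (1 / 2 - del) * D * D by rewrite mulr_ge0 //; lra.
  lra.
rewrite (ltr0_norm D0).
have [d dE] : exists d, D = - d by exists (- D); rewrite opprK.
rewrite dE in D0 D1 D2 *; rewrite opprK {D dE}.
have d0 : 0 < d by lra.
have dd : 0 <= del * d by rewrite mulr_ge0 // ltW.
have Vd : 0 <= V * d by rewrite mulr_ge0 // ltW.
have S0 : 0 <= 2 * V + 1 / 2 + del * - d.
  have : 0 <= (1 / 2 - del) * d by rewrite mulr_ge0 //; lra.
  lra.
have d2 : 0 <= d ^+ 2 by exact: sqr_ge0.
case: e; rewrite ?expr1 ?expr0 ?opprK ?mulN1r ?mul1r ?opprK.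
  rewrite (max_l (_ : - d <= 0)); last by lra.
  apply: (@le_trans _ _ (d / 2 * (2 * V + 1 / 2))); last by lra.
  rewrite mulr0 mul0r addr0; apply: ler_pM => //; last by lra.
  - by rewrite le_max lexx.
  - by lra.
  by rewrite ge_max; apply/andP; split; lra.
rewrite (max_r (ltW d0)).
have : Num.max 0 (del + - d / 2) * (2 * V + 1 / 2 + del * - d) <= (1 - d) / 2 * (2 * V + 1 / 2).
  apply: ler_pM => //; last by lra.
    by rewrite le_max lexx.
  by rewrite ge_max; apply/andP; split; lra.
lra.
Qed.

(** With theta = C - k - 1 / 2 and S = 2 V + 1 / 2 + del D,
    E - F = (del + D / 2) S - theta^2 D and
    2 (E + F) = S^2 + (del + D / 2)^2 - theta^2 (1 + D^2). *)
Lemma mirror_closeness n c x : 0 < x < 1 ->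
  let C := c%:R / 2 in let V := n%:R * (x * (1 - x)) in let d := `|1 - 2 * x| in
  0 <= C - n%:R * x <= 1 / 2 -> 0 < V -> 0 < 2 * V - 1 - d - 2 * d ^+ 2 ->
  forall k : nat, (k.*2 <= c)%N -> (c - k <= n)%N -> (C - k%:R) ^+ 2 <= 4 * V ->
   `|p n k x - p n (c - k) x|
     <= (C - k%:R) * ((1 + d) * (V + (1 + d) / 4) / (V * (2 * V - 1 - d - 2 * d ^+ 2)))
        * (p n k x + p n (c - k) x).
Proof.
move=> x01 C V d; set del := C - _ => del01 V0 den0.
have [x0 x1] := andP x01; have x01' : 0 <= x <= 1 by rewrite !ltW.
set D := 1 - 2 * x in d den0 *.
have D01 : -1 < D < 1 by rewrite /D; apply/andP; split; lra.
set den := V * _; have {}den0 : 0 < den by rewrite mulr_gt0.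
set S := 2 * V + 1 / 2 + del * D.
have d0 : 0 <= d by exact: normr_ge0.
have [Dd Dd'] : - d <= D /\ D <= d by apply/andP; rewrite -ler_norml.
have dD : d ^+ 2 = D ^+ 2 by rewrite real_normK ?num_real.
have d1 : d <= 1 by rewrite ler_norml; case/andP: D01 => *; apply/andP; split; lra.
have [del0 del2] := andP del01.
have SV : 2 * V + 1 / 2 - d / 2 <= S.
  rewrite /S; have : 0 <= del * (D + d) by rewrite mulr_ge0 //; lra.
  have : 0 <= (1 / 2 - del) * d by rewrite mulr_ge0 //; lra.
  lra.
have SS : 4 * V ^+ 2 + 2 * V * (1 - d) <= S ^+ 2.
  apply: (@le_trans _ _ ((2 * V + 1 / 2 - d / 2) ^+ 2)).
    by have : 0 <= (1 / 2 - d / 2) ^+ 2 by [exact: sqr_ge0]; lra.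
  by rewrite ler_sqr ?nnegrE //; lra.
have S0 : 0 <= S by lra.
have yE : n%:R * x = C - del by rewrite /del; ring.
have VE : V = (C - del) * (1 - x) by rewrite -yE /V; ring.
have nE : n%:R = (C - del) / x by rewrite -yE mulfK // gt_eqF.
have H (e : bool) : forall k : nat, (k.*2 <= c)%N -> (c - k <= n)%N -> (C - k%:R) ^+ 2 <= 4 * V ->
   (-1) ^+ e * (p n k x - p n (c - k) x)
     <= (C - k%:R) * ((1 + d) * (V + (1 + d) / 4) / den) * (p n k x + p n (c - k) x).
  move=> k kc ckn kV.
  pose al := Num.max 0 ((-1) ^+ e * (del + D / 2)) * S.
  pose be := Num.max 0 (- (-1) ^+ e * D).
  have al0 : 0 <= al by rewrite mulr_ge0 // le_max lexx.
  have be0 : 0 <= be by rewrite le_max lexx.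
  have skew : al + 4 * V * be / 3 <= (1 + d) * (V + (1 + d) / 4).
    by apply: skew_bound => //; apply: ltW.
  have := @mirror_imbalance R e n c x al be den x01 al0 be0 den0.
  rewrite -/C -/V => /(_ _ _ k kc ckn kV) M; apply: le_trans (M _ _) _.
  - rewrite (_ : _ + _ = S); last by rewrite nE /S VE /D; field; rewrite gt_eqF.
    apply: le_trans SS; rewrite /den; have : 0 <= V * d ^+ 2 by rewrite mulr_ge0 ?sqr_ge0 ?ltW.
    lra.
  - move=> {kc ckn kV M}k kc ckn kV.
    set th := C - k%:R - 1 / 2.
    have thV : th ^+ 2 <= 4 * V.
      have C1 : 1 / 2 <= C - k%:R.
        by rewrite lerBrDr /C ler_pdivlMr // mulrDl divfK // -natrM nat1r ler_nat muln2.
      by apply: le_trans kV; rewrite ler_sqr ?nnegrE /th; lra.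
    have kE : k%:R = C - th - 1 / 2 by rewrite /th; ring.
    have cE : c%:R = 2 * C by rewrite /C; field.
    rewrite -natr1 cE kE; split.
      rewrite (_ : _ + _ = (S ^+ 2 + (del + D / 2) ^+ 2 - th ^+ 2 * (1 + D ^+ 2)) / 2).
        have : th ^+ 2 * (1 + D ^+ 2) <= 4 * V * (1 + D ^+ 2).
          by rewrite ler_wpM2r // addr_ge0 ?sqr_ge0.
        have : 0 <= (del + D / 2) ^+ 2 by exact: sqr_ge0.
        rewrite /den dD; lra.
      by rewrite nE /S VE /D; field; rewrite gt_eqF.
    rewrite (_ : _ - _ = (del + D / 2) * S - th ^+ 2 * D); last first.
      by rewrite nE /S VE /D; field; rewrite gt_eqF.
    rewrite -/th mulrBr mulrA /al /be.
    have h1 : (-1) ^+ e * (del + D / 2) * S <= Num.max 0 ((-1) ^+ e * (del + D / 2)) * S.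
      by rewrite ler_wpM2r // le_max lexx orbT.
    have h2 : - (-1) ^+ e * D * th ^+ 2 <= Num.max 0 (- (-1) ^+ e * D) * th ^+ 2.
      by rewrite ler_wpM2r ?sqr_ge0 // le_max lexx orbT.
    by apply: lerD => //; apply: le_trans h2; rewrite le_eqVlt; apply/orP; left; apply/eqP; ring.
  rewrite ler_wpM2r ?addr_ge0 ?bernstein_basis_ge0 // [leRHS]mulrA ler_pM2r ?invr_gt0 //.
  have Ck : 0 <= C - k%:R.
    by rewrite subr_ge0 /C ler_pdivlMr // -natrM ler_nat muln2.
  have h1 : 0 <= (C - k%:R) * be * (4 * V - (C - k%:R) ^+ 2).
    by rewrite mulr_ge0 ?subr_ge0 // mulr_ge0.
  have h2 : (C - k%:R) * (al + 4 * V * be / 3) <= (C - k%:R) * ((1 + d) * (V + (1 + d) / 4)).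
    by rewrite ler_wpM2l.
  lra.
move=> k kc ckn kV; rewrite ler_norml; apply/andP; split.
  by rewrite lerNl; have := H true k kc ckn kV; rewrite expr1 mulN1r.
by have := H false k kc ckn kV; rewrite expr0 mul1r.
Qed.

End MirrorCloseness.

(** * The common part of the weights and their mirror image *)

Section MirrorOverlap.
Variable R : realType.
Implicit Types (x V : R) (n k c : nat).

Local Notation p n k x := (bernstein_basis n k x).
Local Notation Em := (@bernstein_mean R).

(** The points within two standard deviations of the centre of symmetry
    c / 2. *)
Definition near_centre c V k : bool :=
  (k <= c)%N && ((c%:R / 2 - k%:R) ^+ 2 <= 4 * V).

Lemma near_centre_mirror c V k : (k <= c)%N ->
  near_centre c V (c - k) = near_centre c V k.
Proof.
move=> kc; rewrite /near_centre leq_subr kc natrB //= -[in LHS]sqrrN.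
by congr (_ ^+ 2 <= _); field.
Qed.

Lemma near_centre_le n c V k : c%:R / 2 <= n%:R :> R -> 4 * V <= (n%:R - c%:R / 2) ^+ 2 ->
  near_centre c V k -> (k <= n)%N.
Proof.
move=> Cn Vn /andP[_ kV]; rewrite leqNgt; apply/negP; rewrite -(ltr_nat R) => nk.
have := le_trans kV Vn; rewrite -sqrrN ler_sqr ?nnegrE; lra.
Qed.

Lemma near_centre_far c V k : 4 * V <= (c%:R / 2) ^+ 2 ->
  ~~ near_centre c V k -> 4 * V <= (c%:R / 2 - k%:R) ^+ 2.
Proof.
move=> Vc; rewrite /near_centre negb_and -ltnNge -ltNge => /orP[ck|/ltW //].
apply: le_trans Vc _; rewrite -[leRHS]sqrrN ler_sqr ?nnegrE //.
  by move: ck; rewrite -(ltr_nat R); lra.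
by move: ck; rewrite -(ltr_nat R); have := ler0n R c; lra.
Qed.

Lemma sum_ord_support n m (P : pred nat) (F : nat -> R) :
  (forall k, P k -> (k < n)%N) -> (forall k, P k -> (k < m)%N) ->
  \sum_(k < n | P k) F k = \sum_(k < m | P k) F k.
Proof.
wlog nm : n m / (n <= m)%N.
  move=> W Pn Pm; have [/W|/ltnW /W] := leqP n m; first exact.
  by move/(_ Pm Pn).
move=> Pn Pm; rewrite (big_ord_widen_cond _ P F nm); apply: eq_bigl => k.
by case Pk : (P k) => //=; rewrite Pn.
Qed.

Lemma sum_mirror n c V (F : nat -> R) :
  (forall k, near_centre c V k -> (k <= n)%N) ->
  \sum_(k < n.+1 | near_centre c V k) F (c - k)%N
    = \sum_(k < n.+1 | near_centre c V k) F k.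
Proof.
move=> near_n.
have near_c k : near_centre c V k -> (k < c.+1)%N by case/andP.
rewrite (@sum_ord_support n.+1 c.+1 _ (fun k => F (c - k)%N)) //.
rewrite (@sum_ord_support n.+1 c.+1 _ F) // [RHS](reindex_inj rev_ord_inj) /=.
apply: eq_big => k /=; rewrite subSS => //.
by rewrite near_centre_mirror // -ltnS.
Qed.

(** On a symmetric set, the sum of min (p_k, p_(c-k)) is at least that of
    p_k (1 - T |C - k|).  Subtracting p_k (C - k)^2 / (4 V) makes the summand
    nonpositive outside the set, so the sum may be extended to all k, where it
    only involves E |C - X| and E (C - X)^2. *)
Lemma overlap_ge n c x (s1 : R) : 0 < x < 1 ->
  let C := c%:R / 2 in let V := n%:R * (x * (1 - x)) in let d := `|1 - 2 * x| in
  0 <= C - n%:R * x <= 1 / 2 -> 0 < V -> 0 < 2 * V - 1 - d - 2 * d ^+ 2 ->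
  C <= n%:R -> 4 * V <= (n%:R - C) ^+ 2 -> 4 * V <= C ^+ 2 ->
  0 < s1 -> V + 1 / 4 <= s1 ^+ 2 ->
  1 - (V + 1 / 4) / (4 * V)
    - (1 + d) * (V + (1 + d) / 4) / (V * (2 * V - 1 - d - 2 * d ^+ 2)) * s1
  <= \sum_(k < n.+1 | near_centre c V k) Num.min (p n k x) (p n (c - k) x).
Proof.
move=> x01 C V d del01 V0 den0 Cn nV cV s10 s1V.
have closeness := mirror_closeness x01 del01 V0 den0.
rewrite -/C -/V -/d in closeness.
set T := _ / (V * _) in closeness *.
have [x0 x1] := andP x01; have x01' : 0 <= x <= 1 by rewrite !ltW.
have T0 : 0 <= T.
  have d0 : 0 <= d by exact: normr_ge0.
  apply: divr_ge0; last by apply: mulr_ge0; apply: ltW.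
  by apply: mulr_ge0; lra.
have near_n k : near_centre c V k -> (k <= n)%N by exact: near_centre_le.
apply: (@le_trans _ _ (\sum_(k < n.+1 | near_centre c V k)
    (1 - `|C - k%:R| * T) * p n k x)); last first.
  apply: (@le_trans _ _ (\sum_(k < n.+1 | near_centre c V k)
      (1 - `|C - k%:R| * T) * ((p n k x + p n (c - k) x) / 2))).
    have -> : \sum_(k < n.+1 | near_centre c V k) (1 - `|C - k%:R| * T) * p n k x
      = (\sum_(k < n.+1 | near_centre c V k) (1 - `|C - k%:R| * T) * p n k x
        + \sum_(k < n.+1 | near_centre c V k) (1 - `|C - (c - k)%:R| * T) * p n (c - k) x) / 2.
      by rewrite (sum_mirror (fun k => (1 - `|C - k%:R| * T) * p n k x) near_n); field.
    rewrite -big_split mulr_suml /= ler_sum // => k /andP[kc _].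
    rewrite natrB // (_ : C - (c%:R - k%:R) = - (C - k%:R)); last by rewrite /C; field.
    by rewrite normrN le_eqVlt; apply/orP; left; apply/eqP; field.
  apply: ler_sum => k nk; have [kc kV] := andP nk; have kn := near_n _ nk.
  have : `|p n k x - p n (c - k) x| <= `|C - k%:R| * T * (p n k x + p n (c - k) x).
    have [kk|kk] := leqP k.*2 c.
      have Ck : 0 <= C - k%:R by rewrite subr_ge0 /C ler_pdivlMr // -natrM ler_nat muln2.
      rewrite (ger0_norm Ck); apply: closeness => //.
      by move: nk; rewrite -near_centre_mirror // => /near_n.
    have Ck : C - k%:R <= 0 by rewrite subr_le0 /C ler_pdivrMr // -natrM ler_nat muln2 ltnW.
    have := closeness (c - k)%N; rewrite subKn // distrC (addrC (p n (c - k)%N x) (p n k x)) natrB //.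
    rewrite (_ : C - (c%:R - k%:R) = `|C - k%:R|); last by rewrite ler0_norm // /C; field.
    rewrite real_normK ?num_real //; apply => //.
    by clear -kk; lia.
  rewrite minr_absE; lra.
have [M1 M2 _ _] := bernstein_central_moments n x.
apply: (@le_trans _ _ (Em n x (fun k => 1 - `|C - k%:R| * T - (C - k%:R) ^+ 2 / (4 * V)))); last first.
  rewrite [leRHS]big_mkcond; apply: ler_sum => k _.
  have pk0 : 0 <= p n k x by exact: bernstein_basis_ge0.
  case: ifPn => [_|far].
    by rewrite ler_wpM2r // gerBl divr_ge0 ?sqr_ge0 // mulr_ge0 // ltW.
  rewrite mulr_le0_ge0 // subr_le0 lerBlDl.
  have : 1 <= (C - k%:R) ^+ 2 / (4 * V).
    rewrite ler_pdivlMr; last by rewrite mulr_gt0.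
    by rewrite mul1r; exact: near_centre_far.
  move/le_trans; apply; rewrite lerDr mulr_ge0 //.
(* The square a (|C - k| - s1)^2 turns |C - k| into a quadratic
   polynomial, whose mean is known. *)
pose a := T / (2 * s1).
set del := C - n%:R * x in del01.
apply: (@le_trans _ _ (Em n x (fun k => (1 - a * s1 ^+ 2) - (a + (4 * V)^-1) * del ^+ 2
   + (- (a + (4 * V)^-1) * (k%:R - n%:R * x) ^+ 2
      + 2 * del * (a + (4 * V)^-1) * (k%:R - n%:R * x))))); last first.
  apply: bernstein_mean_le => // k _.
  rewrite -(real_normK (num_real (C - k%:R))).
  have E : `|C - k%:R| ^+ 2 = del ^+ 2 - 2 * del * (k%:R - n%:R * x) + (k%:R - n%:R * x) ^+ 2.
    by rewrite real_normK ?num_real // /del; ring.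
  have : 0 <= a * (`|C - k%:R| - s1) ^+ 2 by rewrite mulr_ge0 ?sqr_ge0 // divr_ge0 // mulr_ge0 // ltW.
  rewrite (_ : a * _ ^+ 2 = a * `|C - k%:R| ^+ 2 + a * s1 ^+ 2 - `|C - k%:R| * T); last first.
    by rewrite /a; field; rewrite gt_eqF.
  rewrite E; lra.
rewrite bernstein_meanD bernstein_mean_cst bernstein_meanD !bernstein_meanZ M1 M2 mulr0 addr0 -/V.
have a0 : 0 <= a by rewrite divr_ge0 // mulr_ge0 // ltW.
have -> : T * s1 = a * (2 * s1 ^+ 2) by rewrite /a; field; rewrite gt_eqF.
have del4 : V + del ^+ 2 <= V + 1 / 4.
  have [d0 d1] := andP del01.
  have : 0 <= (1 / 2 - del) * (1 / 2 + del) by rewrite mulr_ge0 //; lra.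
  lra.
have h1 : a * (V + del ^+ 2) <= a * s1 ^+ 2 by rewrite ler_wpM2l // (le_trans del4).
have h2 : (4 * V)^-1 * (V + del ^+ 2) <= (4 * V)^-1 * (V + 1 / 4).
  by rewrite ler_wpM2l // invr_ge0 mulr_ge0 // ltW.
rewrite [_ / (4 * V)]mulrC; lra.
Qed.

End MirrorOverlap.

(** Here q is the inverse standard deviation.  The two estimates b1 and b2 are
    sharp up to rounding, with maxima near d = 1 / 5 and d = 1 / 3. *)
Lemma overlap_numeric (R : realFieldType) (d q : R) :
  0 <= d <= 1 -> 0 < q -> 23 / 12 * q <= 1 - d ^+ 2 ->
  (1 + d + 2 * d ^+ 2) * q ^+ 2 <= 1 /\
  (1 + d) * (1 + (1 + d) * q ^+ 2 / 4) * (1 + q ^+ 2 / 8) * q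
    <= (3 / 4 - q ^+ 2 / 16 - 13 / 40 * (1 - d ^+ 2))
       * (2 - (1 + d + 2 * d ^+ 2) * q ^+ 2).
Proof.
move=> /andP[d0 d1] q0.
have [z zE] : exists z, z = 1 - d ^+ 2 by exists (1 - d ^+ 2).
have d2 : 0 <= d ^+ 2 by exact: sqr_ge0.
have [e2 e3 e4] : [/\ d ^+ 2 <= 1, d ^+ 3 <= 1 & d ^+ 4 <= 1] by rewrite !expr_le1.
have z1 : z <= 1 by rewrite zE lerBlDr lerDl.
have z0 : 0 <= z by rewrite zE subr_ge0.
rewrite -zE => qz.
have q1 : q <= 12 / 23 * z by clear -qz; lra.
have q2 : q ^+ 2 <= 3 / 11 * z ^+ 2.
  apply: (@le_trans _ _ ((12 / 23 * z) ^+ 2)).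
    rewrite ler_sqr ?nnegrE //; first exact: ltW.
    by apply: le_trans q1; exact: ltW.
  by rewrite exprMn ler_wpM2r ?sqr_ge0 //; clear; lra.
have qq0 : 0 <= q ^+ 2 by exact: sqr_ge0.
have z2 : z ^+ 2 <= 1 by rewrite expr_le1.
have b1 : (1 + d) * z ^+ 2 <= 10 / 9.
  rewrite -subr_ge0 (_ : _ - _ = (d - 1 / 5) ^+ 2 * (331 / 125 + 37 / 25 * d - 7 / 5 * d ^+ 2 - d ^+ 3)
    + (1 / 9 - 331 / 125 / 25)); last by rewrite zE; field.
  apply: addr_ge0; [apply: mulr_ge0; first exact: sqr_ge0|by clear; lra].
  by clear -d0 e2 e3; lra.
have b2 : (1 + d + 2 * d ^+ 2) * z ^+ 2 <= 16 / 13.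
  rewrite -subr_ge0 (_ : _ - _ = (d - 1 / 3) ^+ 2
     * (167 / 81 + 91 / 27 * d + 5 / 3 * d ^+ 2 - 7 / 3 * d ^+ 3 - 2 * d ^+ 4)
    + (3 / 13 - 167 / 81 / 9)); last by rewrite zE; field.
  apply: addr_ge0; [apply: mulr_ge0; first exact: sqr_ge0|by clear; lra].
  have : d ^+ 3 <= d by rewrite exprS ler_piMr.
  have : d ^+ 4 <= d ^+ 2 by rewrite (exprD _ 2 2) ler_piMr.
  by clear -d0 e2; lra.
have a1 : (1 + d) * q ^+ 2 <= 10 / 33.
  have : (1 + d) * q ^+ 2 <= (1 + d) * (3 / 11 * z ^+ 2) by rewrite ler_wpM2l // addr_ge0.
  by clear -b1; lra.
have a2 : (1 + d + 2 * d ^+ 2) * q ^+ 2 <= 48 / 143.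
  have : (1 + d + 2 * d ^+ 2) * q ^+ 2 <= (1 + d + 2 * d ^+ 2) * (3 / 11 * z ^+ 2).
    by rewrite ler_wpM2l // !addr_ge0 ?mulr_ge0.
  by clear -b2; lra.
split; first by clear -a2; lra.
have p1 : 0 <= (1 + d) * q ^+ 2 by rewrite mulr_ge0 // addr_ge0.
apply: (@le_trans _ _ ((1 + d) * (71 / 66) * (91 / 88) * (12 / 23 * z))).
  have h1 : (1 + d) * (1 + (1 + d) * q ^+ 2 / 4) <= (1 + d) * (71 / 66).
    by rewrite ler_wpM2l ?addr_ge0 //; clear -a1; lra.
  have h1' : 0 <= (1 + d) * (1 + (1 + d) * q ^+ 2 / 4).
    by rewrite mulr_ge0 // !addr_ge0 // divr_ge0.
  have h2 : 1 + q ^+ 2 / 8 <= 91 / 88 by clear -q2 z2; lra.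
  have h2' : 0 <= 1 + q ^+ 2 / 8 by rewrite addr_ge0 // divr_ge0.
  by apply: ler_pM => //; [exact: mulr_ge0|exact: ltW|exact: ler_pM].
apply: (@le_trans _ _ ((3 / 4 - 3 / 176 - 13 / 40 * z) * (238 / 143))); last first.
  by apply: ler_pM; [clear -z1; lra|clear; lra|clear -q2 z2; lra|clear -a2; lra].
rewrite zE.
have : 0 <= (d - 1 / 4) ^+ 2 * d by rewrite mulr_ge0 ?sqr_ge0.
have : 0 <= (d - 2 / 9) ^+ 2 by exact: sqr_ge0.
clear -d0; lra.
Qed.

Section PairsRegime.
Variable R : realType.
Implicit Types (x V : R) (n k c : nat).

Local Notation p n k x := (bernstein_basis n k x).

Lemma cubic_le_4_27 x : 0 <= x <= 1 -> x * (1 - x) ^+ 2 <= 4 / 27.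
Proof.
move=> /andP[x0 x1].
rewrite -subr_ge0 (_ : _ - _ = (x - 1 / 3) ^+ 2 * (4 / 3 - x)); last by field.
by rewrite mulr_ge0 ?sqr_ge0 //; clear -x1; lra.
Qed.

Lemma pairs_regime_mean n x : 0 < x < 1 -> 23 / 100 <= n%:R * (x * (1 - x)) ^+ 3 ->
  6 <= n%:R * x.
Proof.
move=> /andP[x0 x1] ns.
have y0 : 0 <= n%:R * x by rewrite mulr_ge0 // ltW.
have : n%:R * (x * (1 - x)) ^+ 3 <= n%:R * x * (1 / 4 * (4 / 27)).
  rewrite (_ : n%:R * _ ^+ 3 = n%:R * x * (x * (1 - x) * (x * (1 - x) ^+ 2))); last by ring.
  have x01 : 0 <= x <= 1 by rewrite !ltW.
  rewrite ler_wpM2l //; apply: ler_pM; rewrite ?mulr_ge0 ?exprn_ge0 ?subr_ge0 ?(ltW x0) ?(ltW x1) //.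
    exact: variance_le_quarter.
  exact: cubic_le_4_27.
by clear -ns; lra.
Qed.

Lemma pairs_regime_variance n x : 0 < x < 1 -> 23 / 100 <= n%:R * (x * (1 - x)) ^+ 3 ->
  92 / 25 <= n%:R * (x * (1 - x)).
Proof.
move=> /andP[x0 x1] ns.
have s0 : 0 < x * (1 - x) by rewrite mulr_gt0 ?subr_gt0.
have s4 := variance_le_quarter x.
have V0 : 0 <= n%:R * (x * (1 - x)) by rewrite mulr_ge0 // ltW.
have s2 : (x * (1 - x)) ^+ 2 <= (1 / 4) ^+ 2 by rewrite ler_sqr ?nnegrE ?(ltW s0).
have := ler_wpM2l V0 s2; rewrite -mulrA -exprS.
by move: ns; clear; lra.
Qed.

(** The bound of [overlap_ge] depends on V and d = |1 - 2 x| only.  As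
    1 - d^2 = 4 s, the regime says that the standard deviation is at least
    about 23 / (12 (1 - d^2)), and the bound is worst at equality. *)
Lemma pairs_regime_overlap n c x : 0 < x < 1 ->
  let C := c%:R / 2 in let V := n%:R * (x * (1 - x)) in
  0 <= C - n%:R * x <= 1 / 2 ->
  23 / 100 <= n%:R * (x * (1 - x)) ^+ 3 ->
  (forall k, near_centre c V k -> (k <= n)%N) /\
  13 / 10 * (x * (1 - x))
    <= \sum_(k < n.+1 | near_centre c V k) Num.min (p n k x) (p n (c - k) x).
Proof.
move=> x01 C V del01 ns; have [x0 x1] := andP x01; have [del0 del2] := andP del01.
have s0 : 0 < x * (1 - x) by rewrite mulr_gt0 ?subr_gt0.
have y6 := pairs_regime_mean x01 ns.
have y6' : 6 <= n%:R * (1 - x).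
  apply: pairs_regime_mean; first by rewrite subr_gt0 x1 gtrBl.
  by rewrite subKr [_ * x]mulrC.
have V4 := pairs_regime_variance x01 ns; rewrite -/V in V4.
have V0 : 0 < V by move: V4; clear; lra.
have Cn : C <= n%:R by move: y6' del2; clear; lra.
have VC : 4 * V <= C ^+ 2.
  apply: (@le_trans _ _ ((n%:R * x) ^+ 2)).
    have : V <= n%:R * x by rewrite /V mulrA ler_piMr ?(le_trans _ y6) // gerBl ltW.
    have : 0 <= (n%:R * x - 6) * (n%:R * x) by rewrite mulr_ge0 ?subr_ge0 ?(le_trans _ y6).
    by move: y6; clear; lra.
  by rewrite ler_sqr ?nnegrE ?(le_trans _ y6) //; move: y6 del0; clear; lra.
have Vn : 4 * V <= (n%:R - C) ^+ 2.
  apply: (@le_trans _ _ ((n%:R * (1 - x) - 1 / 2) ^+ 2)).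
    have : V <= n%:R * (1 - x).
      by rewrite /V mulrCA ler_piMl ?(le_trans _ y6') // ltW.
    have : 0 <= (n%:R * (1 - x) - 6) * (n%:R * (1 - x)).
      by rewrite mulr_ge0 ?subr_ge0 ?(le_trans _ y6').
    by move: y6'; clear; lra.
  by rewrite ler_sqr ?nnegrE; move: y6' Cn del2; clear; lra.
split; first by move=> k; exact: near_centre_le.
have [d dE] : exists d, d = `|1 - 2 * x| by eexists.
have d0 : 0 <= d by rewrite dE normr_ge0.
have d1 : d <= 1 by rewrite dE ler_norml; apply/andP; split; move: x0 x1; clear; lra.
have d2 : 1 - d ^+ 2 = 4 * (x * (1 - x)) by rewrite dE real_normK ?num_real //; ring.
pose q := (Num.sqrt V)^-1.
have q0 : 0 < q by rewrite invr_gt0 sqrtr_gt0.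
have qq : V = (q ^+ 2)^-1 by rewrite /q exprVn invrK sqr_sqrtr // ltW.
have qz : 23 / 12 * q <= 1 - d ^+ 2.
  have ? : 0 <= 23 / 12 * q by rewrite mulr_ge0 ?divr_ge0 ?(ltW q0).
  have ? : 0 <= 4 * (x * (1 - x)) by apply: mulr_ge0 => //; exact: ltW.
  rewrite d2 -ler_sqr ?nnegrE //.
  have e : V * (23 / 12 * q) ^+ 2 = (23 / 12) ^+ 2 by rewrite qq; field; rewrite gt_eqF.
  rewrite -(ler_pM2l V0) e exprMn mulrCA.
  have := ns; rewrite exprS mulrA -/V; clear; lra.
have [den le] := overlap_numeric (introT andP (conj d0 d1)) q0 qz.
have den0 : 0 < 2 * V - 1 - d - 2 * d ^+ 2.
  rewrite -(pmulr_rgt0 _ (exprn_gt0 2 q0)) qq.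
  rewrite (_ : q ^+ 2 * _ = 2 - (1 + d + 2 * d ^+ 2) * q ^+ 2); last by field; rewrite gt_eqF.
  by move: den; clear; lra.
(* With q the inverse square root of V, V q + q / 8 is a bound for the
   square root of V + 1 / 4 that is rational in q. *)
have := @overlap_ge R n c x ((q ^+ 2)^-1 * q + q / 8) x01.
rewrite -/C -/V -dE => /(_ del01 V0 den0 Cn Vn VC); move=> H; apply: le_trans (H _ _); first last.
- rewrite qq -subr_ge0 (_ : _ - _ = (q / 8) ^+ 2); last by field; rewrite gt_eqF.
  exact: sqr_ge0.
- apply: addr_gt0; last by apply: divr_gt0.
  by apply: mulr_gt0 => //; rewrite invr_gt0 exprn_gt0.
rewrite -subr_ge0 {H}.
have D0 : 0 < 2 - (1 + d + 2 * d ^+ 2) * q ^+ 2 by move: den; clear; lra.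
rewrite -(pmulr_rge0 _ D0).
rewrite [X in 0 <= X](_ : _ = (3 / 4 - q ^+ 2 / 16 - 13 / 40 * (4 * (x * (1 - x))))
       * (2 - (1 + d + 2 * d ^+ 2) * q ^+ 2) - (1 + d) * (1 + (1 + d) * q ^+ 2 / 4) * (1 + q ^+ 2 / 8) * q).
  by rewrite -d2 subr_ge0.
rewrite qq; field; rewrite !gt_eqF //.
by move: D0; clear; lra.
Qed.

End PairsRegime.

(** * Large n s^3: mass in symmetric pairs *)

Section MirrorTransport.
Variable R : realType.
Implicit Types (x V : R) (n k c j : nat) (w vs : nat -> R).

Local Notation p n k x := (bernstein_basis n k x).

(** Below C the weights stay; those above are moved to the reflections, in the
    mean y, of their mirror images below C. *)
Definition mirror_node c (y : R) k : R :=
  if (k.*2 < c)%N then k%:R else if k.*2 == c then y else 2 * y - (c%:R - k%:R).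

Lemma mirror_node_sum c y k : (k <= c)%N ->
  mirror_node c y k + mirror_node c y (c - k) = 2 * y.
Proof.
move=> kc; rewrite /mirror_node doubleB.
have [k1|k1|k1] := ltngtP k.*2 c.
- have -> : (c.*2 - k.*2 < c)%N = false by lia.
  have -> : (c.*2 - k.*2 == c)%N = false by lia.
  by rewrite natrB //; ring.
- have -> : (c.*2 - k.*2 < c)%N by lia.
  by rewrite natrB //; ring.
- have -> : (c.*2 - k.*2 < c)%N = false by lia.
  have -> : (c.*2 - k.*2 == c)%N by lia.
  by ring.
Qed.

Lemma mirror_node_dist c y k (C := c%:R / 2) : 0 <= C - y <= 1 / 2 ->
  (mirror_node c y k - y) ^+ 2 <= (C - k%:R) ^+ 2.
Proof.
move=> /andP[d0 d1]; rewrite /mirror_node.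
have cE : c%:R = 2 * C by rewrite /C; field.
have [k1|k1|k1] := ltngtP k.*2 c.
- have k1' : k%:R + 1 / 2 <= C.
    rewrite /C ler_pdivlMr // mulrDl divfK // -natrM.
    by rewrite natr1 ler_nat muln2.
  by rewrite -sqrrN ler_sqr ?nnegrE; move: k1' d0 d1; clear; lra.
- have k1' : C + 1 / 2 <= k%:R.
    rewrite /C -mulrDl ler_pdivrMr // -natrM.
    by rewrite natr1 ler_nat muln2.
  by rewrite cE -[leRHS]sqrrN ler_sqr ?nnegrE; move: k1' d0 d1; clear; lra.
- by rewrite subrr expr0n sqr_ge0.
Qed.

Lemma reachable_mirror_node n j c y k (C := c%:R / 2) : (1 < j <= n)%N -> (k <= n)%N ->
  0 <= y -> 0 <= C - y <= 1 / 2 -> reachable n j k (mirror_node c y k).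
Proof.
move=> jn kn y0 /andP[d0 d1]; rewrite /mirror_node.
have cE : c%:R = 2 * C by rewrite /C; field.
have [k1|k1|k1] := ltngtP k.*2 c.
- exact: reachable_id.
- have k0 : 1 <= k%:R :> R by rewrite ler1n; lia.
  apply: reachable_lower => //; first by rewrite cE; lra.
  by apply/andP; split; lra.
- have kE : k%:R = C by rewrite /C -k1 -muln2 natrM mulfK.
  by apply: reachable_lower => //; rewrite kE; apply/andP; split; lra.
Qed.

Lemma sum_mirror_pair n c V w (F : nat -> R) :
  (forall k, near_centre c V k -> (k <= n)%N) ->
  (forall k, ~~ near_centre c V k -> w k = 0) ->
  (forall k, (k <= c)%N -> w (c - k)%N = w k) ->
  2 * \sum_(k < n.+1) w k * F k
    = \sum_(k < n.+1 | near_centre c V k) w k * (F k + F (c - k)%N).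
Proof.
move=> near_n w0 wsym.
have -> : \sum_(k < n.+1) w k * F k = \sum_(k < n.+1 | near_centre c V k) w k * F k.
  rewrite [RHS]big_mkcond; apply: eq_bigr => k _.
  by case: ifPn => // /w0 ->; rewrite mul0r.
rewrite mulr_natl mulr2n -[X in _ + X](sum_mirror (fun k => w k * F k) near_n) -big_split /=.
apply: eq_bigr => k /andP[kc _]; rewrite wsym //.
by rewrite mulrDr.
Qed.

(** After the move the mass [w] is symmetric about y.  At distance u from y the
    slack is at least (W / 2) (1 + u^2 / n) on average over a pair; times 2 n,
    this pays W u^2 for the second moment of [w] itself and leaves n W per unit
    of mass for that of the rest. *)
Lemma mirror_transport n j c x up w vs : 0 < x < 1 -> (1 < j <= n)%N ->
  let C := c%:R / 2 in let y := n%:R * x in let V := n%:R * (x * (1 - x)) in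
  0 <= C - y <= 1 / 2 ->
  (forall k, near_centre c V k -> (k <= n)%N) ->
  (forall k, ~~ near_centre c V k -> w k = 0) ->
  (forall k, (k <= c)%N -> w (c - k)%N = w k) ->
  (forall k, (k <= n)%N -> 0 <= w k <= p n k x /\ reachable n j k (vs k)) ->
  (let excess := \sum_(k < n.+1) (p n k x - w k) * (vs k - y) in
   if up then 0 <= excess else excess <= 0) ->
  \sum_(k < n.+1) (p n k x - w k) * (vs k - y) ^+ 2 <= n%:R * \sum_(k < n.+1) w k ->
  transportable n j x up.
Proof.
move=> x01 jn C y V del01 near_n w0 wsym wP mom rest.
have [x0 x1] := andP x01.
have n0 : 0 < n%:R :> R by rewrite ltr0n; case/andP: jn => /ltnW j0; exact: leq_trans.
have y0 : 0 <= y by rewrite mulr_ge0 // ltW.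
pose sg := mirror_node c y.
have rsg k : (k <= n)%N -> reachable n j k (sg k) by move=> kn; exact: reachable_mirror_node.
have sg_sum k : near_centre c V k -> sg k + sg (c - k)%N = 2 * y.
  by case/andP => kc _; exact: mirror_node_sum.
have pair F := @sum_mirror_pair n c V w F near_n w0 wsym.
exists w, sg, vs; split.
- by move=> k kn; have [? ?] := wP k kn; split=> //; exact: rsg.
- rewrite /spread big_split /= -/y.
  have -> : \sum_(k < n.+1) w k * (sg k - y) ^+ 1 = 0.
    apply: (mulfI (_ : 2 != 0 :> R)) => //.
    rewrite mulr0 (pair (fun k => (sg k - y) ^+ 1)) big1 // => k nk.
    by rewrite !expr1 addrACA sg_sum // -opprD (_ : 2 * y - (y + y) = 0) ?mulr0 //; ring.
  by rewrite add0r; move: mom; case: (up); under eq_bigr do rewrite -[vs _ - y]expr1.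
- move=> W q W0 [qy qP].
  rewrite /spread big_split /= -/y.
  rewrite [2 * n%:R]mulrC -mulrA (pair (fun k => q (sg k))).
  have gain : W * (n%:R * \sum_(k < n.+1) w k + \sum_(k < n.+1) w k * (sg k - y) ^+ 2)
     <= n%:R * \sum_(k < n.+1 | near_centre c V k) w k * (q (sg k) + q (sg (c - k)%N)).
    rewrite mulrDr mulrCA -[X in n%:R * (W * X)]mul1r.
    have -> : \sum_(k < n.+1) w k = \sum_(k < n.+1 | near_centre c V k) w k.
      rewrite [RHS]big_mkcond; apply: eq_bigr => k _.
      by case: ifPn => // /w0 ->.
    have -> : \sum_(k < n.+1) w k * (sg k - y) ^+ 2
        = \sum_(k < n.+1 | near_centre c V k) w k * (sg k - y) ^+ 2.
      rewrite [RHS]big_mkcond; apply: eq_bigr => k _.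
      by case: ifPn => // /w0 ->; rewrite mul0r.
    rewrite mul1r !mulr_sumr -big_split /=; apply: ler_sum => k nk.
    have kn := near_n _ nk; have [/andP[wk0 _] _] := wP k kn.
    rewrite (_ : _ + _ = n%:R * (w k * (W * (1 + (sg k - y) ^+ 2 / n%:R)))); last first.
      by field; rewrite gt_eqF.
    rewrite ler_wpM2l ?(ltW n0) // ler_wpM2l //.
    have ss := sg_sum _ nk; have [kc kV] := andP nk.
    have [/andP[a0 an] _] := rsg k kn.
    have ckn : (c - k <= n)%N by apply: near_n; rewrite near_centre_mirror.
    have [/andP[b0 bn] _] := rsg _ ckn.
    have un : (sg k - y) ^+ 2 <= n%:R.
      apply: le_trans (mirror_node_dist k del01) _; apply: le_trans kV _.
      have := ler_wpM2l (ltW n0) (variance_le_quarter x); rewrite -/V.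
      by clear; lra.
    have [le|ge] := leP (sg k) y.
      have un' : (y - sg k) ^+ 2 <= n%:R by rewrite -sqrrN opprB.
      have := qP (y - sg k); rewrite subr_ge0 le un' => /(_ isT isT).
      rewrite subKr (_ : y + (y - sg k) = sg (c - k)%N); last by move: ss; clear; lra.
      by move=> /(_ a0 bn); rewrite -[(sg k - y) ^+ 2]sqrrN opprB [leRHS]addrC.
    have := qP (sg k - y); rewrite subr_ge0 (ltW ge) un => /(_ isT isT).
    rewrite subrKC (_ : y - (sg k - y) = sg (c - k)%N); last by move: ss; clear; lra.
    by move=> /(_ b0 an).
  apply: le_trans gain; rewrite ler_wpM2l // addrC lerD2r.
  exact: rest.
Qed.

End MirrorTransport.

Section PairsTransport.
Variable R : realType.
Implicit Types (x V : R) (n k c j : nat) (w vs : nat -> R).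

Local Notation node := (akr_node R).
Local Notation p n k x := (bernstein_basis n k x).
Local Notation Em := (@bernstein_mean R).

(** A multiple of the common part min (p_k, p_(c-k)), scaled to mass
    13 s / 10.  Being symmetric about C it has mean C. *)
Lemma mirror_weights n x : 0 < x < 1 -> 23 / 100 <= n%:R * (x * (1 - x)) ^+ 3 ->
  exists c w, let C := c%:R / 2 in let y := n%:R * x in
  let V := n%:R * (x * (1 - x)) in
  [/\ 0 <= C - y <= 1 / 2 /\ (forall k, near_centre c V k -> (k <= n)%N),
      (forall k, ~~ near_centre c V k -> w k = 0) /\
        (forall k, (k <= c)%N -> w (c - k)%N = w k),
      forall k, (k <= n)%N -> 0 <= w k <= p n k x,
      \sum_(k < n.+1) w k = 13 / 10 * (x * (1 - x)) &
      \sum_(k < n.+1) w k * (k%:R - y) = 13 / 10 * (x * (1 - x)) * (C - y)].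
Proof.
move=> x01 ns; have [x0 x1] := andP x01; have x01' : 0 <= x <= 1 by rewrite !ltW.
set y := n%:R * x; set V := n%:R * (x * (1 - x)).
have s0 : 0 < x * (1 - x) by rewrite mulr_gt0 ?subr_gt0.
have y0 : 0 <= y by rewrite mulr_ge0 // ltW.
(* c exceeds 2 y by at most 1, so C exceeds y by at most 1 / 2. *)
pose c := (Num.truncn (2 * y)).+1; pose C : R := c%:R / 2.
have del01 : 0 <= C - y <= 1 / 2.
  have /truncn_itv : 0 <= 2 * y by rewrite mulr_ge0.
  rewrite -/c; have : c%:R = (Num.truncn (2 * y))%:R + 1 :> R by rewrite natr1.
  rewrite /C => cE /andP[]; move: cE; clear => cE h1 h2; apply/andP; split; lra.
have [near_n big] := pairs_regime_overlap x01 del01 ns.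
pose mn k := if near_centre c V k then Num.min (p n k x) (p n (c - k) x) else 0.
set L := 13 / 10 * _ in big *.
have L0 : 0 < L by rewrite mulr_gt0 // divr_gt0.
have GE : \sum_(k < n.+1 | near_centre c V k) Num.min (p n k x) (p n (c - k) x) = \sum_(k < n.+1) mn k.
  by rewrite big_mkcond.
rewrite {}GE in big; set G := \sum_(k < n.+1) mn k in big.
have G0 : 0 < G by exact: lt_le_trans big.
have LG : L / G <= 1 by rewrite ler_pdivrMr // mul1r.
have LG0 : 0 <= L / G by rewrite divr_ge0 // ltW.
pose w k := L / G * mn k.
have w0 k : ~~ near_centre c V k -> w k = 0.
  by move=> nk; rewrite /w /mn (negbTE nk) mulr0.
have wsym k : (k <= c)%N -> w (c - k)%N = w k.
  by move=> kc; rewrite /w /mn near_centre_mirror // subKn // minC.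
have wsum : \sum_(k < n.+1) w k = L by rewrite -mulr_sumr -/G divfK // gt_eqF.
exists c, w; split => //.
  move=> k kn; have m0 : 0 <= mn k.
    by rewrite /mn; case: ifP => // _; rewrite le_min !bernstein_basis_ge0.
  rewrite /w mulr_ge0 //=; apply: (@le_trans _ _ (mn k)); first by rewrite ler_piMl.
  by rewrite /mn; case: ifP => _; rewrite ?ge_min ?lexx // bernstein_basis_ge0.
have -> : \sum_(k < n.+1) w k * (k%:R - y)
   = \sum_(k < n.+1) w k * (k%:R - C) + \sum_(k < n.+1) w k * (C - y).
  by rewrite -big_split; apply: eq_bigr => k _ /=; ring.
rewrite -mulr_suml wsum -[RHS]add0r; congr (_ + _).
apply: (mulfI (_ : 2 != 0 :> R)) => //.
rewrite mulr0 (sum_mirror_pair (fun k => k%:R - C) near_n w0 wsym) big1 // => k /andP[kc _].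
by rewrite natrB // /C [X in _ * X](_ : _ = 0) ?mulr0 //; field.
Qed.

(** The moves that make [w] symmetric already lower the mean, which is the side
    wanted, so the rest may stay. *)
Lemma transportable_down_pairs n j x : 0 < x < 1 -> (1 < j <= n)%N ->
  23 / 100 <= n%:R * (x * (1 - x)) ^+ 3 -> transportable n j x false.
Proof.
move=> x01 jn ns; have [x0 x1] := andP x01; have x01' : 0 <= x <= 1 by rewrite !ltW.
have s0 : 0 < x * (1 - x) by rewrite mulr_gt0 ?subr_gt0.
have [M1 M2 _ _] := bernstein_central_moments n x.
have [c [w [[del01 near_n] [w0 wsym] wp wsum wmean]]] := mirror_weights x01 ns.
have V0 : 0 <= n%:R * (x * (1 - x)) by rewrite mulr_ge0 // ltW.
apply: (mirror_transport x01 jn del01 near_n w0 wsym (vs := fun k => k%:R)).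
- by move=> k kn; split; [exact: wp|exact: reachable_id].
- have -> : \sum_(k < n.+1) (p n k x - w k) * (k%:R - n%:R * x)
     = Em n x (fun k => k%:R - n%:R * x) - \sum_(k < n.+1) w k * (k%:R - n%:R * x).
    by rewrite -sumrB; apply: eq_bigr => k _; ring.
  rewrite /= M1 wmean sub0r oppr_le0 !mulr_ge0 ?subr_ge0 ?(ltW x0) ?(ltW x1) ?divr_ge0 //.
  by case/andP: del01; rewrite subr_ge0.
- rewrite wsum mulrCA; apply: (@le_trans _ _ (n%:R * (x * (1 - x)))); last by move: V0; clear; lra.
  rewrite -M2; apply: ler_sum => k _; rewrite mulrC ler_wpM2l ?sqr_ge0 //.
  by rewrite gerBl; have [/andP[]] := wp k (leq_ord k).
Qed.

Lemma mean_deviation_half n x :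
  Em n x (fun k => Num.max 0 (n%:R * x - k%:R)) = mean_deviation n x / 2.
Proof.
have [M1 _ _ _] := bernstein_central_moments n x.
rewrite (@bernstein_mean_ext _ _ _ _ (fun k => 1 / 2 * `|k%:R - n%:R * x|
    + - (1 / 2) * (k%:R - n%:R * x))); last first.
  by move=> k _; rewrite maxr_absE sub0r normrN distrC; field.
by rewrite bernstein_meanD !bernstein_meanZ M1 mulr0 addr0 mul1r mulrC.
Qed.

(** By de Moivre's telescoping sum (n - k) x p_k is at most half the
    deviation; for k above the mean use the preceding index. *)
Lemma bernstein_basis_le_deviation n k x : 0 < x < 1 -> (k <= n)%N ->
  n%:R * (x * (1 - x)) * p n k x <= mean_deviation n x / 2.
Proof.
move=> /andP[x0 x1]; have x01' : 0 <= x <= 1 by rewrite !ltW.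
have below i : (i <= n)%N -> (n%:R - i%:R) * x * p n i x <= mean_deviation n x / 2.
  move=> ni; rewrite -bernstein_deficit // -mean_deviation_half /bernstein_mean.
  rewrite (big_ord_widen n.+1 (fun k => (n%:R * x - k%:R) * p n k x)) //.
  rewrite big_mkcond /=; apply: ler_sum => m _.
  have pm : 0 <= p n m x by exact: bernstein_basis_ge0.
  case: ifP => _; last by rewrite mulr_ge0 // le_max lexx.
  by rewrite ler_wpM2r // le_max lexx orbT.
move=> kn; have pk : 0 <= p n k x by exact: bernstein_basis_ge0.
have [ky|yk] := leP k%:R (n%:R * x).
  apply: le_trans (below k kn); rewrite ler_wpM2r //.
  have : 0 <= x * (n%:R * x - k%:R) by rewrite mulr_ge0 ?subr_ge0 // ltW.
  by clear; lra.
have k0 : (0 < k)%N by rewrite -(ltr0n R) (le_lt_trans _ yk) // mulr_ge0 // ltW.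
case: k k0 kn pk yk => // k _ kn pk yk.
apply: le_trans (below k (ltnW kn)); rewrite -bernstein_basis_ratio; last exact: ltnW.
by rewrite ler_wpM2r // mulrA ler_wpM2r ?subr_ge0 // ltW.
Qed.

(** The second moment gives p_n n (1 - x) <= x, and n (1 - x) is at least
    (23 / 100) / (x^3 (1 - x)^2). *)
Lemma bernstein_basis_last_le n x : 0 < x < 1 ->
  23 / 100 <= n%:R * (x * (1 - x)) ^+ 3 -> p n n x <= 96 / 1000.
Proof.
move=> x01 ns; have [x0 x1] := andP x01; have x01' : 0 <= x <= 1 by rewrite !ltW.
have [_ M2 _ _] := bernstein_central_moments n x.
have := @bernstein_mean_ge_term R n x (fun k => (k%:R - n%:R * x) ^+ 2) n x01' (leqnn n).
rewrite M2 => /(_ (fun k _ => sqr_ge0 _)).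
have := bernstein_basis_ge0 n n x01'; move: (p n n x) => P P0 H.
have n0 : 0 < n%:R :> R.
  rewrite lt_neqAle ler0n andbT; apply/eqP => nE; move: ns; rewrite -nE mul0r; clear; lra.
have H' : P * n%:R * (1 - x) <= x.
  rewrite -(ler_pM2l (_ : 0 < n%:R * (1 - x))); last by rewrite mulr_gt0 ?subr_gt0.
  move: H; rewrite (_ : (n%:R - n%:R * x) ^+ 2 * P = n%:R * (1 - x) * (P * n%:R * (1 - x))); last by ring.
  by rewrite (_ : n%:R * (x * (1 - x)) = n%:R * (1 - x) * x) //; ring.
have c4 := @cubic_le_4_27 R (1 - x); rewrite subKr subr_ge0 gerBl (ltW x0) (ltW x1) in c4.
have {}c4 := c4 isT.
have c0 : 0 <= (1 - x) * x ^+ 2 by rewrite mulr_ge0 ?sqr_ge0 // subr_ge0 ltW.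
have h1 : P * (23 / 100) <= P * (n%:R * (x * (1 - x)) ^+ 3) by rewrite ler_wpM2l.
have h2 : P * (n%:R * (x * (1 - x)) ^+ 3) <= ((1 - x) * x ^+ 2) ^+ 2.
  rewrite (_ : _ * (_ * _) = P * n%:R * (1 - x) * ((1 - x) ^+ 2 * x ^+ 3)); last by ring.
  rewrite (_ : ((1 - x) * x ^+ 2) ^+ 2 = x * ((1 - x) ^+ 2 * x ^+ 3)); last by ring.
  by rewrite ler_wpM2r // mulr_ge0 ?sqr_ge0 // exprn_ge0 // ltW.
have h3 : ((1 - x) * x ^+ 2) ^+ 2 <= (4 / 27) ^+ 2 by rewrite ler_sqr ?nnegrE // divr_ge0.
by move: (le_trans h1 (le_trans h2 h3)); clear; lra.
Qed.

(** The second moment gives p_1 (y - 1)^2 <= V, where y - 1 >= 5 y / 6. *)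
Lemma bernstein_basis_first_le n x : 0 < x < 1 ->
  23 / 100 <= n%:R * (x * (1 - x)) ^+ 3 -> p n 1 x <= 138 / 1000.
Proof.
move=> x01 ns; have [x0 x1] := andP x01; have x01' : 0 <= x <= 1 by rewrite !ltW.
have [_ M2 _ _] := bernstein_central_moments n x.
have y6 := pairs_regime_mean x01 ns.
have n1 : (1 <= n)%N by rewrite lt0n; apply/eqP => nE; move: ns; rewrite nE mul0r; clear; lra.
have := @bernstein_mean_ge_term R n x (fun k => (k%:R - n%:R * x) ^+ 2) 1 x01' n1.
rewrite M2 => /(_ (fun k _ => sqr_ge0 _)).
have := bernstein_basis_ge0 n 1 x01'; move: (p n 1 x) => P P0 H.
have n0 : 0 < n%:R :> R by rewrite ltr0n.
have H' : P * (25 / 36) * (n%:R * x) <= 1 - x.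
  rewrite -(ler_pM2l (_ : 0 < n%:R * x)); last by rewrite mulr_gt0.
  rewrite (_ : n%:R * x * (1 - x) = n%:R * (x * (1 - x))); last by ring.
  apply: le_trans H; rewrite (_ : _ * (_ * _ * _) = (5 / 6 * (n%:R * x)) ^+ 2 * P); last by field.
  rewrite ler_wpM2r // -[leRHS]sqrrN opprB.
  by rewrite ler_sqr ?nnegrE; move: y6; clear; lra.
have c4 := @cubic_le_4_27 R x x01'.
have c0 : 0 <= x * (1 - x) ^+ 2 by rewrite mulr_ge0 ?sqr_ge0 // ltW.
have h1 : P * (25 / 36) * (23 / 100) <= P * (25 / 36) * (n%:R * (x * (1 - x)) ^+ 3).
  by rewrite ler_wpM2l // mulr_ge0 ?divr_ge0.
have h2 : P * (25 / 36) * (n%:R * (x * (1 - x)) ^+ 3) <= (x * (1 - x) ^+ 2) ^+ 2.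
  rewrite (_ : _ * (n%:R * _) = P * (25 / 36) * (n%:R * x) * (x ^+ 2 * (1 - x) ^+ 3)); last by ring.
  rewrite (_ : (x * (1 - x) ^+ 2) ^+ 2 = (1 - x) * (x ^+ 2 * (1 - x) ^+ 3)); last by ring.
  by rewrite ler_wpM2r // mulr_ge0 ?sqr_ge0 // exprn_ge0 // subr_ge0 ltW.
have h3 : (x * (1 - x) ^+ 2) ^+ 2 <= (4 / 27) ^+ 2 by rewrite ler_sqr ?nnegrE // divr_ge0.
by move: (le_trans h1 (le_trans h2 h3)); clear; lra.
Qed.

End PairsTransport.

Section PairsUp.
Variable R : realType.
Implicit Types (x V : R) (n k c j : nat) (w vs : nat -> R).

Local Notation node := (akr_node R).
Local Notation p n k x := (bernstein_basis n k x).
Local Notation Em := (@bernstein_mean R).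

(** Node j - 1, which lies at 0, and node n, which lies at the end of the
    segment, have no room for moves above k. *)
Definition raisable n j k := (k != j.-1) && (k != n).

Lemma reachable_raised n j k (r : R) : (1 < j <= n)%N -> (k <= n)%N -> raisable n j k ->
  0 <= r <= 3 / 5 -> (j == 2) ==> (r <= 2 / 5) -> reachable n j k (k%:R + r).
Proof.
move=> jn kn /andP[kj kN] /andP[r0 r1] r2; have [j1 jn'] := andP jn.
have kn' : k%:R + 1 <= n%:R :> R by rewrite natr1 ler_nat ltn_neqAle kN.
apply: reachable_range => //.
- by rewrite addr_ge0 //=; move: kn' r1; clear; lra.
- by move: r0; clear; lra.
have [kj'|jk] := ltnP k j.
  have kj2 : (k + 2 <= j)%N by clear -kj kj' j1; lia.
  have : k%:R + 2 <= j%:R :> R by rewrite -natrD ler_nat.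
  have : 0 <= n%:R * node n j k by rewrite mulr_ge0 ?akr_node_ge0.
  by move: r1; clear; lra.
have [j3|j2] := leqP 3 j.
  have := @scaled_node_room3 R n j k; rewrite j3 jk => /(_ isT jn').
  by move: r1; clear; lra.
have jE : j = 2%N by clear -j1 j2; lia.
rewrite jE eqxx /= in r2 jk jn' *.
have := @scaled_node_room2 R n k jk jn'.
by move: r2; clear; lra.
Qed.

(** The rest is shifted by an amount inversely proportional to this mass; the
    two bounds keep the shift within the room of every node. *)
Lemma raisable_mass n j x w : 0 < x < 1 -> (1 < j <= n)%N ->
  23 / 100 <= n%:R * (x * (1 - x)) ^+ 3 ->
  (forall k, (k <= n)%N -> 0 <= w k <= p n k x) ->
  \sum_(k < n.+1) w k = 13 / 10 * (x * (1 - x)) ->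
  let U := \sum_(k < n.+1 | raisable n j k) (p n k x - w k) in
  3 / 10 <= U /\ ((j == 2) ==> (44 / 100 <= U)).
Proof.
move=> x01 jn ns wp wsum U; have [x0 x1] := andP x01; have x01' : 0 <= x <= 1 by rewrite !ltW.
have [j1 jn'] := andP jn.
have jn1 : (j.-1 <= n)%N by clear -jn'; lia.
have UE : 1 - 13 / 10 * (x * (1 - x)) - p n j.-1 x - p n n x <= U.
  rewrite -wsum -[X in X - _ - _ - _](bernstein_mean_cst n x).
  rewrite -(sum_at (fun k => p n k x) jn1) -(sum_at (fun k => p n k x) (leqnn n)).
  rewrite /U [leRHS]big_mkcond /bernstein_mean -!sumrB; apply: ler_sum => k _ /=.
  have /andP[w0 w1] := wp k (leq_ord k).
  rewrite /raisable; case: (_ == j.-1); case: (_ == n) => /=; move: w0 w1; clear; lra.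
have s4 := variance_le_quarter x.
have pn := bernstein_basis_last_le x01 ns.
split.
  have V4 := pairs_regime_variance x01 ns.
  set V := n%:R * (x * (1 - x)) in V4 *.
  have V0 : 0 < V by move: V4; clear; lra.
  have q0 : 0 < Num.sqrt V by rewrite sqrtr_gt0.
  have qV : 23 / 12 <= Num.sqrt V.
    rewrite -[leLHS]ger0_norm ?divr_ge0 // -sqrtr_sqr ler_sqrt; first by move: V4; clear; lra.
    exact: ltW.
  have : p n j.-1 x <= 6 / 23.
    have h := bernstein_basis_le_deviation x01 jn1; rewrite -/V in h.
    have h' := mean_deviation_le n x01'; rewrite -/V in h'.
    have pj := bernstein_basis_ge0 n j.-1 x01'.
    have h2 : V * p n j.-1 x <= Num.sqrt V / 2 by move: h h'; clear; lra.
    have VE : V = Num.sqrt V * Num.sqrt V by rewrite -expr2 sqr_sqrtr // ltW.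
    rewrite {1}VE -mulrA ler_pM2l // in h2.
    have := ler_wpM2r pj qV; move: h2; clear; lra.
  by move: UE s4 pn; clear; lra.
apply/implyP => /eqP jE.
have := bernstein_basis_first_le x01 ns; rewrite jE /= in UE.
by move: UE s4 pn; clear; lra.
Qed.

(** Moving [w] lowers the mean by a total of Ld, which is restored by raising
    all raisable points of the rest by the same amount r.  This increases the
    second moment by at most r times the mean deviation, hence by at most
    3 V / 10, and [w] has mass 13 s / 10 to cover V + 3 V / 10. *)
Lemma transportable_up_pairs n j x : 0 < x < 1 -> (1 < j <= n)%N ->
  23 / 100 <= n%:R * (x * (1 - x)) ^+ 3 -> transportable n j x true.
Proof.
move=> x01 jn ns; have [x0 x1] := andP x01; have x01' : 0 <= x <= 1 by rewrite !ltW.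
have s0 : 0 < x * (1 - x) by rewrite mulr_gt0 ?subr_gt0.
have s4 := variance_le_quarter x.
have [M1 M2 _ _] := bernstein_central_moments n x.
have [c [w [[del01 near_n] [w0 wsym] wp wsum wmean]]] := mirror_weights x01 ns.
have [U3 U2] := raisable_mass x01 jn ns wp wsum.
have V4 := pairs_regime_variance x01 ns.
set V := n%:R * (x * (1 - x)) in M2 V4 *.
set y := n%:R * x in del01 wmean M1 M2 *.
set U := \sum_(k < n.+1 | _) _ in U3 U2.
have U0 : 0 < U by move: U3; clear; lra.
have V0 : 0 < V by move: V4; clear; lra.
set Ld := _ * (_ / 2 - y) in wmean.
have [Ld0 Ld1] : 0 <= Ld /\ Ld <= 13 / 80.
  case/andP: del01 => d0 d1; split; first by rewrite mulr_ge0 // mulr_ge0 ?divr_ge0 // ltW.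
  apply: (@le_trans _ _ (13 / 10 * (1 / 4) * (1 / 2))); last by clear; lra.
  apply: ler_pM => //; first by rewrite mulr_ge0 ?divr_ge0 // ltW.
  by rewrite ler_wpM2l // divr_ge0.
pose r := Ld / U.
have rU : r * U = Ld by rewrite /r divfK // gt_eqF.
have r0 : 0 <= r by rewrite divr_ge0 // ltW.
have r5 : r <= 23 / 40.
  rewrite /r ler_pdivrMr //; move: U3 Ld1; clear; lra.
have r4 : (j == 2) ==> (r <= 2 / 5).
  apply/implyP => /(implyP U2) U4; rewrite /r ler_pdivrMr //; move: U4 Ld1; clear; lra.
pose vs k := if raisable n j k then k%:R + r else k%:R.
have M := mean_deviation_le n x01'; rewrite -/V in M.
have pw : \sum_(k < n.+1) (p n k x - w k) * (k%:R - y) = - Ld.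
  rewrite -wmean -[RHS]add0r -[X in _ = X + _]M1 -sumrB.
  by apply: eq_bigr => k _; ring.
have split_raised (F : R -> R -> R) : \sum_(k < n.+1) (p n k x - w k) * F k%:R (vs k)
  = \sum_(k < n.+1) (p n k x - w k) * F k%:R k%:R
    + \sum_(k < n.+1 | raisable n j k) (p n k x - w k) * (F k%:R (k%:R + r) - F k%:R k%:R).
  rewrite [X in _ = _ + X]big_mkcond -big_split; apply: eq_bigr => k _ /=.
  by rewrite /vs; case: ifP => _; [ring|rewrite addr0].
apply: (mirror_transport x01 jn del01 near_n w0 wsym (vs := vs)).
- move=> k kn; split; first exact: wp.
  rewrite /vs; case: ifP => kr; last exact: reachable_id.
  by apply: reachable_raised => //; rewrite r0 /=; move: r5; clear; lra.
- rewrite /= -/y (split_raised (fun _ z => z - y)) pw.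
  rewrite (eq_bigr (fun k : 'I_n.+1 => r * (p n k x - w k))); last by move=> k _; ring.
  by rewrite -mulr_sumr -/U rU addNr.
- rewrite -/y (split_raised (fun _ z => (z - y) ^+ 2)).
  rewrite [X in _ + X <= _](eq_bigr (fun k : 'I_n.+1 => 2 * r * ((p n k x - w k) * (k%:R - y))
      + r ^+ 2 * (p n k x - w k))) //; last by move=> k _; ring.
  rewrite big_split /= -!mulr_sumr -/U wsum [leRHS]mulrCA -/V.
  have a1 : \sum_(k < n.+1) (p n k x - w k) * (k%:R - y) ^+ 2 <= V.
    rewrite -M2; apply: ler_sum => k _; rewrite mulrC ler_wpM2l ?sqr_ge0 //.
    by rewrite gerBl; have [/andP[]] := wp k (leq_ord k).
  have a2 : \sum_(k < n.+1 | raisable n j k) (p n k x - w k) * (k%:R - y)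
      <= - Ld + mean_deviation n x / 2.
    rewrite -pw -mean_deviation_half /bernstein_mean -big_split /= big_mkcond.
    apply: ler_sum => k _; have /andP[wk0 wk1] := wp k (leq_ord k).
    have m0 : 0 <= Num.max 0 (y - k%:R) by rewrite le_max lexx.
    have m1 : y - k%:R <= Num.max 0 (y - k%:R) by rewrite le_max lexx orbT.
    case: ifP => _; first by rewrite lerDl mulr_ge0 // (le_trans wk0).
    have b0 : 0 <= p n k x - w k by rewrite subr_ge0.
    have := ler_wpM2l b0 m1; have := mulr_ge0 m0 wk0; clear; lra.
  have a3 : 2 * r * \sum_(k < n.+1 | raisable n j k) (p n k x - w k) * (k%:R - y)
      <= 2 * r * (- Ld + mean_deviation n x / 2) by rewrite ler_wpM2l // mulr_ge0.
  have q0 : 0 < Num.sqrt V by rewrite sqrtr_gt0.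
  have qV : 23 / 12 <= Num.sqrt V.
    rewrite -[leLHS]ger0_norm ?divr_ge0 // -sqrtr_sqr ler_sqrt; first by move: V4; clear; lra.
    exact: ltW.
  have VE : V = Num.sqrt V * Num.sqrt V by rewrite -expr2 sqr_sqrtr // ltW.
  have a4 : r * mean_deviation n x <= 3 / 10 * V.
    rewrite {1}VE mulrA; apply: ler_pM => //; last by move: r5 qV; clear; lra.
    by apply: bernstein_mean_ge0 => // k _; exact: normr_ge0.
  have a5 : r ^+ 2 * U = r * Ld by rewrite expr2 -mulrA rU.
  have a6 : 0 <= r * Ld by rewrite mulr_ge0.
  rewrite a5; move: a1 a3 a4 a6; clear; lra.
Qed.

Lemma transport_exists n j x up : 0 < x < 1 -> (1 < j <= n)%N -> transportable n j x up.
Proof.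
move=> x01 jn.
have [ns|/ltW ns] := leP (n%:R * (x * (1 - x)) ^+ 3) (23 / 100).
  exact: transportable_central.
by case: up; [exact: transportable_up_pairs|exact: transportable_down_pairs].
Qed.

End PairsUp.

(** * The moduli of continuity and the operator *)

Section Moduli.
Variable R : realType.
Implicit Types (f : R -> R) (x d u v h : R) (n j : nat).

Lemma bounded_on_segment f : {within `[0, 1], continuous f} ->
  exists M, forall t, t \in `[0, 1] -> `|f t| <= M.
Proof.
move=> fc; have [c _ cmin] := EVT_min ler01 fc; have [c' _ cmax] := EVT_max ler01 fc.
exists (Num.max (f c') (- f c)) => t t01.
rewrite ler_norml lerNl !le_max lerN2.
by rewrite cmin // cmax // orbT.
Qed.

Lemma omega1_ge f d u v : {within `[0, 1], continuous f} ->
  u \in `[0, 1] -> v \in `[0, 1] -> `|u - v| <= d -> `|f u - f v| <= omega1 f d.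
Proof.
move=> fc u01 v01 uv; have [M fM] := bounded_on_segment fc.
apply: ub_le_sup; last by exists u, v.
exists (M + M) => _ [u' [v' [u'01 v'01 _ ->]]].
by apply: le_trans (ler_normB _ _) _; apply: lerD; apply: fM.
Qed.

Lemma omega2_ge f d u h : {within `[0, 1], continuous f} ->
  0 <= h <= d -> u - h \in `[0, 1] -> u + h \in `[0, 1] ->
  `|f (u + h) - 2 * f u + f (u - h)| <= omega2 f d.
Proof.
move=> fc hd um up; have [M fM] := bounded_on_segment fc.
apply: ub_le_sup; last by exists u, h.
exists (M + 2 * M + M) => _ [u' [h' [h'd u'm u'p ->]]].
have u'01 : u' \in `[0, 1] by move: u'm u'p; rewrite !in_itv /= => /andP[? ?] /andP[? ?]; apply/andP; split; lra.
apply: le_trans (ler_normD _ _) _; apply: lerD; last exact: fM.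
apply: le_trans (ler_normB _ _) _; apply: lerD; first exact: fM.
by rewrite normrM ger0_norm // ler_wpM2l // fM.
Qed.

Lemma omega2_ge0 f d : {within `[0, 1], continuous f} -> 0 <= d -> 0 <= omega2 f d.
Proof.
move=> fc d0; apply: le_trans (omega2_ge (u := 0) (h := 0) fc _ _ _).
- exact: normr_ge0.
- by rewrite lexx.
- by rewrite subr0 in_itv /= lexx ler01.
- by rewrite addr0 in_itv /= lexx ler01.
Qed.

End Moduli.

Section Operator.
Variable R : realType.
Implicit Types (f g : R -> R) (x a : R) (n j : nat).

Lemma akr_operatorB n j f g x :
  akr_operator n j (f \- g) x = akr_operator n j f x - akr_operator n j g x.
Proof. by rewrite -sumrB; apply: eq_bigr => k _; rewrite /= mulrBl. Qed.

Lemma akr_operatorN n j f x :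
  akr_operator n j (\- f) x = - akr_operator n j f x.
Proof. by rewrite -sumrN; apply: eq_bigr => k _; rewrite /= mulNr. Qed.

Lemma akr_operator_monomial n j a x : (0 < j <= n)%N ->
  akr_operator n j (a \*o monomial j) x = a * x ^+ j.
Proof.
move=> /andP[j0 jn].
transitivity (a * ((n ^_ j)%:R^-1 * bernstein_mean n x (fun k => (k ^_ j)%:R))).
  rewrite /bernstein_mean !mulr_sumr; apply: eq_bigr => k _.
  by rewrite /= /monomial akr_node_exp //; ring.
by rewrite bernstein_mean_ffact mulKf // pnatr_eq0 -lt0n ffact_gt0.
Qed.

Lemma akr_operator0 n j f : (0 < j <= n)%N -> akr_operator n j f 0 = f 0.
Proof.
move=> jn; rewrite /akr_operator big_ord_recl big1 /= => [|i _].
  rewrite addr0 /bernstein_basis subn0 bin0 expr0 subr0 expr1n !mulr1.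
  have : 0 < n%:R :> R by rewrite ltr0n; case/andP: jn; apply: leq_trans.
  move=> n0; have /eqP := @scaled_node_small R n j 0 jn.
  by rewrite mulf_eq0 gt_eqF //= => /eqP ->.
by rewrite /bernstein_basis /bump /= add1n expr0n /= mulr0 mul0r mulr0.
Qed.

Lemma akr_operator1 n j f : (0 < j <= n)%N -> akr_operator n j f 1 = f 1.
Proof.
move=> /andP[j0 jn]; rewrite /akr_operator big_ord_recr big1 /= => [|i _].
  rewrite add0r /bernstein_basis subnn binn subrr expr0 expr1n !mulr1.
  have : akr_node R n j n ^+ j = 1 by rewrite akr_node_exp // divff // pnatr_eq0 -lt0n ffact_gt0.
  by move/eqP; rewrite pexpr_eq1 ?akr_node_ge0 // => /eqP ->.
by rewrite /bernstein_basis subrr expr0n subn_eq0 leqNgt ltn_ord !mulr0.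
Qed.

Lemma continuous_subtract_monomial f a j : {within `[0, 1], continuous f} ->
  {within `[0, 1], continuous (f \- (a \*o monomial j))}.
Proof.
move=> fc; apply: (within_continuousB fc); apply: continuous_subspaceT => t.
by rewrite /monomial; apply: cvgM; [exact: cvg_cst|exact: exprn_continuous].
Qed.

(** One-sided; the other side is the same statement for the opposite
    function. *)
Lemma akr_error g n j x : {within `[0, 1], continuous g} -> 0 < x < 1 ->
  (1 < j <= n)%N ->
  akr_operator n j g x - g x <= omega2 g (1 / Num.sqrt n%:R) + omega1 g ((j%:R - 1) / n%:R).
Proof.
move=> gc x01 jn1; have /andP[j1 jn] := jn1.
have j0 : (0 < j)%N by apply: leq_trans j1.
have n0 : 0 < n%:R :> R by rewrite ltr0n (leq_trans j0).
have s0 : 0 < Num.sqrt n%:R :> R by rewrite sqrtr_gt0.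
have jn' : (0 < j <= n)%N by rewrite j0.
apply: (transport_bound gc _ _ _ x01 jn' (transport_exists true x01 jn1)
  (transport_exists false x01 jn1)).
- by rewrite omega2_ge0 // divr_ge0 // ltW.
- move=> u t t0 nt um up; apply: omega2_ge => //.
  + rewrite t0 /= ler_pdivlMr // -(ler_pXn2r (ltn0Sn 1)) ?nnegrE ?mulr_ge0 ?(ltW s0) ?ler01 //.
    by rewrite exprMn sqr_sqrtr ?(ltW n0) // expr1n mulrC.
  + by rewrite in_itv /= um /=; lra.
  + by rewrite in_itv /= up andbT; lra.
- by move=> u v u01 v01 uv; apply: omega1_ge; rewrite ?in_itv.
Qed.

End Operator.

Theorem proposition2p3 (R : realType) (j : nat) (hj : (1 < j)%N)
    (f : R -> R) (hf : {within `[0, 1], continuous f})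
    (x : R) (hx : x \in `[0, 1]) (n : nat) (hn : (j <= n)%N) :
  `|f x - akr_operator n j f x| <=
    inf [set omega2 (f \- l) (1 / Num.sqrt n%:R)
             + omega1 (f \- l) ((j%:R - 1) / n%:R)
        | l in [set l : R -> R | exists a : R, l = a \*o monomial j] ].
Proof.
have jn : (0 < j <= n)%N by rewrite hn (ltnW hj).
apply: lb_le_inf.
  by exists (omega2 (f \- (0 \*o monomial j)) (1 / Num.sqrt n%:R)
    + omega1 (f \- (0 \*o monomial j)) ((j%:R - 1) / n%:R)), (0 \*o monomial j) => //; exists 0.
move=> _ [l [a ->] <-]; set g := f \- _.
have gc : {within `[0, 1], continuous g} by exact: continuous_subtract_monomial.
have -> : f x - akr_operator n j f x = g x - akr_operator n j g x.
  by rewrite akr_operatorB akr_operator_monomial // /g /= /monomial; ring.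
have g0 : 0 <= omega2 g (1 / Num.sqrt n%:R) + omega1 g ((j%:R - 1) / n%:R).
  rewrite addr_ge0 ?omega2_ge0 ?divr_ge0 ?sqrtr_ge0 //.
  apply: le_trans (omega1_ge (u := 0) (v := 0) gc _ _ _); rewrite ?normr_ge0 ?in_itv /= ?lexx ?ler01 //.
  by rewrite subrr normr0 divr_ge0 // subr_ge0 ler1n (ltnW hj).
move: hx; rewrite in_itv /= => /andP[].
rewrite le_eqVlt => /orP[/eqP <- _|x0]; first by rewrite akr_operator0 // subrr normr0.
rewrite le_eqVlt => /orP[/eqP ->|x1]; first by rewrite akr_operator1 // subrr normr0.
have x01 : 0 < x < 1 by rewrite x0.
have jn1 : (1 < j <= n)%N by rewrite hj.
rewrite ler_norml lerNl opprB; apply/andP; split; first exact: akr_error.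
have Ng : {within `[0, 1], continuous (\- g)} by move=> t; apply: cvgN; exact: gc.
have := akr_error Ng x01 jn1.
rewrite akr_operatorN /= opprK addrC.
have -> : omega1 (\- g) ((j%:R - 1) / n%:R) = omega1 g ((j%:R - 1) / n%:R).
  congr sup; apply/seteqP; split => _ [u [v [u01 v01 uv ->]]]; exists u, v; split => //=.
    by rewrite -opprD normrN.
  by rewrite -opprD normrN.
have -> // : omega2 (\- g) (1 / Num.sqrt n%:R) = omega2 g (1 / Num.sqrt n%:R).
congr sup; apply/seteqP; split => _ [u [h [hd um up ->]]]; exists u, h; split => //=;
  by rewrite -normrN; congr (`| _ |); ring.
Qed.
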